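(* Use the setting of the context: the channel and noise model, the states, the actions $a\in\{0,1\}$, the error covariance $\mathbf{C}_{\rm e}$, the reward $\mathsf{R}$, the a-posteriori probabilities $\theta_k[n]$, the detected symbol vectors $\hat{\mathbf{x}}[n]$, and the soft-decision symbol vectors $\tilde{\mathbf{x}}[n]$. Let $b\in\{1,\ldots,N_{\rm B}\}$, $n\in\mathcal{N}_b$, $L=\max\mathcal{N}_b=T_{\rm p}+bT_{\rm d}$, and let ${\rm S}_n=(\mathbf{X}_n,\hat{\mathbf{X}}_n,\mathcal{M})\in\mathcal{S}_n$. Assume $\hat{\mathbf{x}}[n]\neq \mathbf{0}$. Assume that the transition function and the optimal value function are given by (A1) $\mathsf{T}^{(1,j)}({\rm S}_n)=\theta_j[n]$ for $j\in\{1,\ldots,K\}$, and $\mathsf{T}^{(0,0)}({\rm S}_n)=1$; (A2) for each $a\in\{0,1\}$ and $j\in\mathcal{J}_a$, $$\mathsf{V}^\star\big(\mathsf{U}_{n+1}^{(a,j)}({\rm S}_n)\big)=\sum_{m=n+1}^{L}\mathsf{R}\big(\hat{\mathsf{U}}_m^{(a,j)}({\rm S}_n),\hat{\mathsf{U}}_{m+1}^{(a,j)}({\rm S}_n)\big),$$ where $\hat{\mathsf{U}}_{n+1}^{(a,j)}({\rm S}_n):=\mathsf{U}_{n+1}^{(a,j)}({\rm S}_n)$, $\hat{\mathsf{U}}_m^{(a,j)}({\rm S}_n)$ for $m\ge n+2$ is the virtual state defined in the context, and the sum is $0$ if $n=L$. Let $$\mathsf{Q}({\rm S}_n,a)=\sum_{j\in\mathcal{J}_a}\mathsf{T}^{(a,j)}({\rm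 S}_n)\Big\{\mathsf{R}\big({\rm S}_n,\mathsf{U}_{n+1}^{(a,j)}({\rm S}_n)\big)+\mathsf{V}^\star\big(\mathsf{U}_{n+1}^{(a,j)}({\rm S}_n)\big)\Big\},$$ and let $\pi^\star({\rm S}_n)=\arg\max_{a\in\{0,1\}}\mathsf{Q}({\rm S}_n,a)$ be the optimal policy, with ties resolved in favor of $a=1$. Then $$\pi^\star({\rm S}_n)=\mathbb{I}\left[\frac{\sigma^2(1+\alpha_n)+\sigma^4\|\mathbf{t}_n\|^2+\|\mathbf{v}_n\|^2}{2\sigma^4\beta_n+\delta_n+\|\mathbf{e}_n-\mathbf{u}_n+\mathbf{v}_n\|^2}\ge 1\right],$$ where $\mathbb{I}[\cdot]$ equals $1$ if the condition holds and $0$ otherwise, and $$\mathbf{Q}_n=\Big(\hat{\mathbf{X}}_n\hat{\mathbf{X}}_n^{\mathsf H}+\sum_{m=n+1}^{L}\tilde{\mathbf{x}}[m]\tilde{\mathbf{x}}^{\mathsf H}[m]+\sigma^2\mathbf{I}_{N_{\rm tx}}\Big)^{-1},\qquad \mathbf{D}_n=\hat{\mathbf{X}}_n(\hat{\mathbf{X}}_n-\mathbf{X}_n)^{\mathsf H}+\sigma^2\mathbf{I}_{N_{\rm tx}},$$ $$\mathbf{t}_n=\mathbf{Q}_n\hat{\mathbf{x}}[n],\qquad \mathbf{u}_n=\mathbf{D}_n^{\mathsf H}\mathbf{t}_n,\qquad \mathbf{e}_n=\hat{\mathbf{x}}[n]-\tilde{\mathbf{x}}[n],$$ $$\alpha_n=\hat{\mathbf{x}}^{\mathsf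 H}[n]\mathbf{Q}_n\hat{\mathbf{x}}[n],\qquad \beta_n=(1+\alpha_n)\frac{\mathbf{t}_n^{\mathsf H}\mathbf{Q}_n\mathbf{t}_n}{\|\mathbf{t}_n\|^2},\qquad \mathbf{v}_n=(1+\alpha_n)\frac{\mathbf{D}_n^{\mathsf H}\mathbf{Q}_n\mathbf{t}_n}{\|\mathbf{t}_n\|^2},$$ $$\delta_n=\sum_{j=1}^{K}\theta_j[n]\,\|\hat{\mathbf{x}}[n]-\mathbf{x}_j\|^2-\|\hat{\mathbf{x}}[n]-\tilde{\mathbf{x}}[n]\|^2 .$$
   Context: **Signal model.** $N_{\rm tx},N_{\rm rx},T_{\rm p},T_{\rm d},N_{\rm B}$ are positive integers and $\sigma^2>0$. $(\cdot)^{\mathsf H}$ is the conjugate transpose and $\|\cdot\|$ the Euclidean norm. The channel is $\mathbf{H}=[\mathbf{h}_1,\ldots,\mathbf{h}_{N_{\rm rx}}]\in\mathbb{C}^{N_{\rm tx}\times N_{\rm rx}}$ with $\mathbf{h}_r\sim\mathcal{CN}(\mathbf{0},\mathbf{I}_{N_{\rm tx}})$. If $\mathbf{x}[n]\in\mathbb{C}^{N_{\rm tx}}$ is sent at time $n$, the received signal is $\mathbf{y}[n]=\mathbf{H}^{\mathsf H}\mathbf{x}[n]+\mathbf{z}[n]\in\mathbb{C}^{N_{\rm rx}}$ with entries $y_r[n]$. The noise $\mathbf{z}[n]\sim\mathcal{CN}(\mathbf{0},\sigma^2\mathbf{I}_{N_{\rm rx}})$ is independent over time and independent of the channel. Times $1,\ldots,T_{\rm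 p}$ carry known pilots, the columns of a fixed matrix $\mathbf{X}^{\rm p}\in\mathbb{C}^{N_{\rm tx}\times T_{\rm p}}$; $\mathbf{y}_r^{\rm p}$ is the row vector of the received pilot samples at antenna $r$. The $b$-th data block occupies times $\mathcal{N}_b=\{T_{\rm p}+(b-1)T_{\rm d}+1,\ldots,T_{\rm p}+bT_{\rm d}\}$, $b=1,\ldots,N_{\rm B}$. Data symbol vectors lie in $\mathcal{X}^{N_{\rm tx}}=\{\mathbf{x}_1,\ldots,\mathbf{x}_K\}$, where $\mathcal{X}\subset\mathbb{C}$ is a finite constellation and $K=|\mathcal{X}|^{N_{\rm tx}}$. **Data detection outputs.** With equal priors $1/K$, the a-posteriori probabilities are $\theta_k[n]=\mathbb{P}[\mathbf{x}[n]=\mathbf{x}_k\mid\mathbf{y}[n]]=\dfrac{\exp(-\|\mathbf{y}[n]-\mathbf{H}^{\mathsf H}\mathbf{x}_k\|^2/\sigma^2)}{\sum_{j=1}^K\exp(-\|\mathbf{y}[n]-\mathbf{H}^{\mathsf H}\mathbf{x}_j\|^2/\sigma^2)}$, where $\mathbf{H}$ is the channel matrix used by the receiver's detector; in particular $\theta_k[n]\ge 0$ and $\sum_k\theta_k[n]=1$. The detected vector is $\hat{\mathbf{x}}[n]=\arg\max_{\mathbf{x}_k}\theta_k[n]$. The soft-decision vector is $\tilde{\mathbf{x}}[n]=\sum_{k=1}^K\theta_k[n]\mathbf{x}_k$. In all quantities below, $\theta_k[n],\hat{\mathbf{x}}[n],\tilde{\mathbf{x}}[n]$ are treated as given, fixed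 (deterministic) quantities. **States.** $\mathcal{S}_n$ is the set of triples $(\mathbf{X}_n,\hat{\mathbf{X}}_n,\mathcal{M})$ with $\mathcal{M}\subset\{T_{\rm p}+1,\ldots,n-1\}$, $\mathbf{X}_n=[\mathbf{X}^{\rm p},\mathbf{x}_{k_1},\ldots,\mathbf{x}_{k_{|\mathcal{M}|}}]$ for some $k_i\in\{1,\ldots,K\}$, and $\hat{\mathbf{X}}_n=[\mathbf{X}^{\rm p},\hat{\mathbf{x}}[\mathcal{M}(1)],\ldots,\hat{\mathbf{x}}[\mathcal{M}(|\mathcal{M}|)]]$, where $\mathcal{M}(i)$ is the $i$-th smallest element of $\mathcal{M}$. Here $\mathbf{X}_n$ represents the vectors actually transmitted and $\hat{\mathbf{X}}_n$ the vectors used as pilots by the receiver. **Channel estimate and error covariance.** For a state, or a virtual state (below), ${\rm S}=(\mathbf{X},\hat{\mathbf{X}},\mathcal{M})$, the received row vector at antenna $r$ is $\bar{\mathbf{y}}_r({\rm S})=[\mathbf{y}_r^{\rm p},y_r[\mathcal{M}(1)],\ldots,y_r[\mathcal{M}(|\mathcal{M}|)]]$, modeled as $\bar{\mathbf{y}}_r({\rm S})=\mathbf{h}_r^{\mathsf H}\mathbf{X}+\bar{\mathbf{z}}_r$, with $\bar{\mathbf{z}}_r$ having i.i.d. $\mathcal{CN}(0,\sigma^2)$ entries independent of $\mathbf{h}_r$. The channel estimate is $\hat{\mathbf{h}}_r({\rm S})=(\hat{\mathbf{X}}\hat{\mathbf{X}}^{\mathsf H}+\sigma^2\mathbf{I}_{N_{\rm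 tx}})^{-1}\hat{\mathbf{X}}\,\bar{\mathbf{y}}_r^{\mathsf H}({\rm S})$. The error covariance is $\mathbf{C}_{\rm e}({\rm S})=\mathbb{E}[(\hat{\mathbf{h}}_r({\rm S})-\mathbf{h}_r)(\hat{\mathbf{h}}_r({\rm S})-\mathbf{h}_r)^{\mathsf H}]$, with expectation over the channel and noise only ($\mathbf{X},\hat{\mathbf{X}}$ fixed); it does not depend on $r$. **Reward.** $\mathsf{R}({\rm S},{\rm S}')={\rm Tr}[\mathbf{C}_{\rm e}({\rm S})-\mathbf{C}_{\rm e}({\rm S}')]$. **Actions and next states.** The action $a=1$ means that $\hat{\mathbf{x}}[n]$ is used as an additional pilot, and $a=0$ that it is not. Put $\mathcal{J}_0=\{0\}$, $\mathcal{J}_1=\{1,\ldots,K\}$. From ${\rm S}_n=(\mathbf{X}_n,\hat{\mathbf{X}}_n,\mathcal{M})$ the possible next states are $\mathsf{U}_{n+1}^{(1,j)}({\rm S}_n)=([\mathbf{X}_n,\mathbf{x}_j],[\hat{\mathbf{X}}_n,\hat{\mathbf{x}}[n]],\mathcal{M}\cup\{n\})$ for $j\in\mathcal{J}_1$, and $\mathsf{U}_{n+1}^{(0,0)}({\rm S}_n)=(\mathbf{X}_n,\hat{\mathbf{X}}_n,\mathcal{M})$. $\mathsf{T}^{(a,j)}({\rm S}_n)$ denotes the probability of moving from ${\rm S}_n$ to $\mathsf{U}_{n+1}^{(a,j)}({\rm S}_n)$ under action $a$. $\mathsf{V}^\star$ denotes the optimal (undiscounted) sum of future rewards until the end of the current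 data block. **Virtual states.** For $m\ge n+2$, $\hat{\mathsf{U}}_m^{(a,j)}({\rm S}_n)=(\mathbf{X}_m^{(a,j)},\hat{\mathbf{X}}_m^{(a)},\mathcal{M}_m^{(a)})$, where - for $a=1$, $j\in\mathcal{J}_1$: $\mathbf{X}_m^{(1,j)}=[\mathbf{X}_n,\mathbf{x}_j,\tilde{\mathbf{x}}[n+1],\ldots,\tilde{\mathbf{x}}[m-1]]$, $\hat{\mathbf{X}}_m^{(1)}=[\hat{\mathbf{X}}_n,\hat{\mathbf{x}}[n],\tilde{\mathbf{x}}[n+1],\ldots,\tilde{\mathbf{x}}[m-1]]$, $\mathcal{M}_m^{(1)}=\mathcal{M}\cup\{n,\ldots,m-1\}$; - for $a=0$, $j=0$: $\mathbf{X}_m^{(0,0)}=[\mathbf{X}_n,\tilde{\mathbf{x}}[n+1],\ldots,\tilde{\mathbf{x}}[m-1]]$, $\hat{\mathbf{X}}_m^{(0)}=[\hat{\mathbf{X}}_n,\tilde{\mathbf{x}}[n+1],\ldots,\tilde{\mathbf{x}}[m-1]]$, $\mathcal{M}_m^{(0)}=\mathcal{M}\cup\{n+1,\ldots,m-1\}$. *)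

(* Defs.v *)
From HB Require Import structures.
From mathcomp Require Import all_boot all_order all_algebra.
From mathcomp Require Import finmap complex.
From mathcomp Require Import all_classical all_reals all_analysis.

Set Implicit Arguments.
Unset Strict Implicit.
Unset Printing Implicit Defensive.

Import Order.TTheory GRing.Theory Num.Theory.
Import numFieldNormedType.Exports.

Local Open Scope classical_set_scope.
Local Open Scope complex_scope.
Local Open Scope sesquilinear_scope.
Local Open Scope ring_scope.

Section Probability.
Context {d : measure_display} {Om : measurableType d} {R : realType}.
Variable P : probability Om R.

(* Mutual independence of the classes of events G i for i in D *)
Definition mutually_independent (I : choiceType) (D : set I)
    (G : I -> set_system Om) : Prop :=
  forall (J : {fset I}) (E : I -> set Om),
    [set` J] `<=` D -> (forall i, i \in J -> G i (E i)) ->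
    P (\bigcap_(i in [set` J]) E i) = (\prod_(i <- J) P (E i))%E.

(* A complex random matrix is handled through its real coordinates: the entry
   (i, j) gives its real part (c = false) and its imaginary part (c = true). *)
Definition coord (m k : nat) (Z : Om -> 'M[R[i]]_(m, k))
    (ijc : 'I_m * 'I_k * bool) : Om -> R :=
  fun w => let z := Z w ijc.1.1 ijc.1.2 in
           if ijc.2 then complex.Im z else complex.Re z.

Definition coord_events (m k : nat) (Z : Om -> 'M[R[i]]_(m, k))
    (ijc : 'I_m * 'I_k * bool) : set_system Om :=
  preimage_set_system setT (coord Z ijc) measurable.

Definition sigma_of (m k : nat) (Z : Om -> 'M[R[i]]_(m, k)) : set_system Om :=
  <<s \bigcup_ijc coord_events Z ijc >>.

(* Z ~ CN(0, s I): circular symmetry makes the 2k real coordinates i.i.d. with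
   law N(0, s / 2); the second argument of normal_prob is the standard
   deviation. *)
Definition complex_normal (k : nat) (s : R) (Z : Om -> 'cV[R[i]]_k) : Prop :=
  [/\ forall ijc, measurable_fun setT (coord Z ijc),
      forall ijc (B : set R), measurable B ->
        P (coord Z ijc @^-1` B) = normal_prob 0 (Num.sqrt (s / 2)) B
    & mutually_independent setT (coord_events Z)].

(* fine sends infinite expectations to 0; it is applied below to variables that
   are integrable, being quadratic in Gaussian coordinates. *)
Definition complex_expectation (Z : Om -> R[i]) : R[i] :=
  fine 'E_P[fun w => complex.Re (Z w)] +i* fine 'E_P[fun w => complex.Im (Z w)].

End Probability.

Definition enorm (R : realType) (k : nat) (v : 'cV[R[i]]_k) : R :=
  Num.sqrt (\sum_i (complex.Re (v i 0) ^+ 2 + complex.Im (v i 0) ^+ 2)).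

Section Detection.
Variables (R : realType) (Ntx Nrx K : nat) (sigma2 : R).
Variable xs : 'I_K -> 'cV[R[i]]_Ntx.
Variable Hdet : nat -> 'M[R[i]]_(Ntx, Nrx).
Variable y : nat -> 'cV[R[i]]_Nrx.

(* Up to a factor independent of k, which cancels in app. The detector may use
   a different channel matrix at each time. *)
Definition likelihood (k : 'I_K) (t : nat) : R :=
  expR (- (enorm (y t - (Hdet t)^t* *m xs k) ^+ 2 / sigma2)).

(* A-posteriori probability of xs k at time t, under equal priors *)
Definition app (k : 'I_K) (t : nat) : R :=
  likelihood k t / \sum_(j < K) likelihood j t.

Definition soft_decision (t : nat) : 'cV[R[i]]_Ntx :=
  \sum_(k < K) (app k t)%:C *: xs k.

End Detection.

Section States.
Variables (R : realType) (Ntx : nat).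

(* (X, Xhat, M); the column count is part of the state, so that appending
   columns needs no transport. It equals Tp + |M| for the states used below. *)
Record state := State {
  ncol : nat;
  sent : 'M[R[i]]_(Ntx, ncol);
  used : 'M[R[i]]_(Ntx, ncol);
  times : {fset nat} }.

(* M(i), with i counted from 0 *)
Definition nth_time (M : {fset nat}) (i : nat) : nat := nth 0%N (sort leq M) i.

(* S_n *)
Definition is_state (Tp K : nat) (Xp : 'M[R[i]]_(Ntx, Tp))
    (xs : 'I_K -> 'cV[R[i]]_Ntx) (xhat : nat -> 'cV[R[i]]_Ntx)
    (n : nat) (S : state) : Prop :=
  exists (M : {fset nat}) (k : 'I_#|` M| -> 'I_K),
    (forall t, t \in M -> (Tp < t < n)%N) /\
    S = State (row_mx Xp (\matrix_(i < Ntx, l < #|` M|) xs (k l) i 0))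
              (row_mx Xp (\matrix_(i < Ntx, l < #|` M|) xhat (nth_time M l) i 0)) M.

(* |J_a|: the index sets J_1 and J_0 are represented by 'I_K and 'I_1 *)
Definition outcomes (K : nat) (a : bool) : nat := if a then K else 1.

(* U_{n+1}^{(a,j)}(S) *)
Definition next_state (K : nat) (xs : 'I_K -> 'cV[R[i]]_Ntx)
    (xhat : nat -> 'cV[R[i]]_Ntx) (n : nat) (S : state) (a : bool) :
    'I_(outcomes K a) -> state :=
  match a return 'I_(outcomes K a) -> state with
  | true => fun j => State (row_mx (sent S) (xs j)) (row_mx (used S) (xhat n))
                           (times S `|` [fset n])%fset
  | false => fun _ => S
  end.

(* [x t1, ..., x (t2 - 1)] *)
Definition columns (x : nat -> 'cV[R[i]]_Ntx) (t1 t2 : nat) :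
    'M[R[i]]_(Ntx, t2 - t1) := \matrix_(i, l) x (t1 + l)%N i 0.

(* \hat U_m^{(a,j)}(S), which is U_{n+1}^{(a,j)}(S) at m = n + 1 *)
Definition virtual_state (K : nat) (xs : 'I_K -> 'cV[R[i]]_Ntx)
    (xhat xtilde : nat -> 'cV[R[i]]_Ntx) (n : nat) (S : state) (m : nat)
    (a : bool) (j : 'I_(outcomes K a)) : state :=
  let U := next_state xs xhat n S j in
  if (m <= n.+1)%N then U else
  State (row_mx (sent U) (columns xtilde n.+1 m))
        (row_mx (used U) (columns xtilde n.+1 m))
        (times U `|` [fset t in iota n.+1 (m - n.+1)])%fset.

End States.

Section Reward.
Context {d : measure_display} {Om : measurableType d} {R : realType}.
Variable P : probability Om R.
Variables (Ntx Nrx Tp : nat) (sigma2 : R).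
Variable H : Om -> 'M[R[i]]_(Ntx, Nrx).
Variable z : nat -> Om -> 'cV[R[i]]_Nrx.
Variable r : 'I_Nrx.

(* Time at which column l of a state is received: 1, ..., Tp, M(1), M(2), ... *)
Definition column_time (S : state R Ntx) (l : nat) : nat :=
  if (l < Tp)%N then l.+1 else nth_time (times S) (l - Tp).

Definition received (S : state R Ntx) (w : Om) : 'rV[R[i]]_(ncol S) :=
  (col r (H w))^t* *m sent S + \row_l z (column_time S l) w r 0.

Definition channel_estimate (S : state R Ntx) (w : Om) : 'cV[R[i]]_Ntx :=
  invmx (used S *m (used S)^t* + (sigma2%:C)%:M) *m used S *m (received S w)^t*.

Definition error_cov (S : state R Ntx) : 'M[R[i]]_Ntx :=
  \matrix_(i, j) complex_expectation P (fun w =>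
    let e := channel_estimate S w - col r (H w) in (e *m e^t*) i j).

(* The trace is real, error covariances being Hermitian *)
Definition reward (S S' : state R Ntx) : R :=
  complex.Re (\tr (error_cov S - error_cov S')).

End Reward.

Section Policy.
Variables (R : realType) (Ntx K : nat).
Variable trans : state R Ntx -> forall a : bool, 'I_(outcomes K a) -> R.
Variable rew : state R Ntx -> state R Ntx -> R.
Variable V : state R Ntx -> R.
Variable next : state R Ntx -> forall a : bool, 'I_(outcomes K a) -> state R Ntx.

Definition Qvalue (S : state R Ntx) (a : bool) : R :=
  \sum_(j : 'I_(outcomes K a)) trans S j * (rew S (next S j) + V (next S j)).

Definition maximizers (q : bool -> R) : pred bool :=
  [pred a | [forall a' : bool, q a' <= q a]].

(* Ties go to the action 1, i.e. true *)
Definition optimal_policy (S : state R Ntx) : bool :=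
  if true \in maximizers (Qvalue S) then true else false.

End Policy.

(* Main.v *)
Require Import Defs.
From HB Require Import structures.
From mathcomp Require Import all_boot all_order all_algebra.
From mathcomp Require Import finmap complex.
From mathcomp Require Import all_classical all_reals all_analysis.
From mathcomp Require Import measurable_realfun ring lra.

Set Implicit Arguments.
Unset Strict Implicit.
Unset Printing Implicit Defensive.

Import Order.TTheory GRing.Theory Num.Theory.
Import numFieldNormedType.Exports.

Local Open Scope classical_set_scope.
Local Open Scope complex_scope.
Local Open Scope sesquilinear_scope.
Local Open Scope ring_scope.

(* By the model, the estimation error of a state is a linear image of the
   channel and the noise, whose real coordinates are centred and uncorrelated;
   with A = (Xhat Xhat^H + sigma^2 I)^-1 and D = Xhat (Xhat - X)^H + sigma^2 I
   this gives
     Tr C_e = |A D|^2 + sigma^2 Tr A - sigma^4 |A|^2   (Frobenius norms).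
   Under (A2) the rewards telescope, so the two actions are compared through
   Tr C_e at the last virtual states. The soft decisions occur both in X and
   in Xhat, hence do not contribute to D. Compared with the action 0, the
   outcome j of the action 1 adds xhat xhat^H to A^-1 and xhat (xhat - x_j)^H
   to D. The Sherman-Morrison formula computes the resulting change of Tr C_e;
   its theta-average is (|t|^2 / (1 + alpha)^2) (denominator - numerator). *)

(** * Moments of the normal law *)

Section normal_moments.
Context {R : realType}.
Implicit Types (m s x : R).
Local Notation mu := (@lebesgue_measure R).

(** [normal_prob m s] is absolutely continuous with respect to Lebesgue measure. Its Radon-Nikodym
    derivative and [normal_pdf m s] have the same integral over every measurable set, so they agree
    almost everywhere. *)
Lemma ge0_integral_normal_prob m s (g : R -> \bar R) :
  (forall x, 0 <= g x)%E -> measurable_fun [set: R] g ->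
  (\int[normal_prob m s]_x g x = \int[mu]_x (g x * (normal_pdf m s x)%:E))%E.
Proof.
move=> g0 mg; have dom := @normal_prob_dominates R m s.
rewrite -(Radon_Nikodym_SigmaFinite.change_of_variables dom)//.
apply: ae_eq_integral => //.
- apply: emeasurable_funM => //; apply: (measurable_int mu).
  exact: Radon_Nikodym_SigmaFinite.f_integrable.
- apply: emeasurable_funM => //; apply/measurable_EFinP.
  exact: measurable_normal_pdf.
- apply: ae_eqe_mul2l; apply: integral_ae_eq => //.
  + exact: Radon_Nikodym_SigmaFinite.f_integrable.
  + by apply/measurable_EFinP; exact: measurable_normal_pdf.
  + by move=> E _ mE; rewrite -Radon_Nikodym_SigmaFinite.f_integral.
Qed.

Lemma is_derive_normal_fun s x :
  is_derive x (1 : R) (normal_fun 0 s) (- (x / s ^+ 2) * normal_fun 0 s x).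
Proof.
rewrite /normal_fun; apply: is_derive_eq.
rewrite /GRing.scale /= subr0 -mulr_natr invfM.
(* Naming the inverse leaves [field] no nonzero side condition, so [s = 0] is covered as well. *)
by move: (s ^+ 2)^-1 => y; field.
Qed.

Lemma is_derive_expR_affine (a b x : R) :
  is_derive x (1 : R) (fun x : R => expR (a - x / b))
    (- b^-1 * expR (a - x / b)).
Proof.
by apply: is_derive_eq; rewrite /GRing.scale /= mulr1; ring.
Qed.

(** With y = x^2 / (2 s^2), the bound exp(y) >= 1 + y >= y gives x exp(-y) <= 2 s^2 / x for x > 0,
    and the right-hand side tends to 0. *)
Lemma mul_normal_fun_cvg0 s : s != 0 ->
  x * normal_fun 0 s x @[x --> +oo] --> (0 : R).
Proof.
move=> s0.
have s2 : 0 < s ^+ 2 by rewrite exprn_even_gt0.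
apply: (@squeeze_cvgr _ _ _ _ (cst 0) (fun x => (2 * s ^+ 2) * x^-1)).
- near=> x; apply/andP; split.
    by rewrite mulr_ge0 ?normal_fun_ge0//; near: x; exact: nbhs_pinfty_ge.
  have x0 : 0 < x by near: x; exact: nbhs_pinfty_gt.

  have y0 : 0 < x ^+ 2 / (s ^+ 2 *+ 2) by rewrite divr_gt0 ?exprn_gt0 ?pmulrn_lgt0.
  have -> : 2 * s ^+ 2 * x^-1 = x * (x ^+ 2 / (s ^+ 2 *+ 2))^-1.
    by rewrite -mulr_natr; field; rewrite s0 gt_eqF.
  rewrite ler_pM2l// /normal_fun subr0 mulNr expRN lef_pV2 ?posrE ?expR_gt0//.
  by rewrite (le_trans _ (expR_ge1Dx _))// lerDr.
- exact: cvg_cst.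
- rewrite -(mulr0 (2 * s ^+ 2)); apply: cvgMr.
  by apply/gtr0_cvgV0 => //; exact: nbhs_pinfty_gt.
Unshelve. all: by end_near.
Qed.

Lemma is_derive_continuous (f df : R -> R) :
  (forall x, is_derive x (1 : R) f (df x)) -> continuous f.
Proof.
move=> hf x; apply: differentiable_continuous.
by apply/derivable1_diffP; have [] := hf x.
Qed.

Lemma ge0_integral_derive_itvcy (f F : R -> R) (a l : R) :
  (forall x, a <= x -> 0 <= f x) -> continuous f ->
  (forall x, is_derive x (1 : R) F (f x)) -> F x @[x --> +oo] --> l ->
  (\int[mu]_(x in `[a, +oo[) (f x)%:E = (l - F a)%:E)%E.
Proof.
move=> f0 cf dF Fl; rewrite (@ge0_continuous_FTC2y R f F a l)//.
- exact: continuous_subspaceT.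
- apply: cvg_at_right_filter; exact: is_derive_continuous dF a.
- by move=> x _; rewrite derive1E; have [] := dF x.
Qed.

Lemma expR_affine_cvg0 (a b : R) : 0 < b ->
  expR (a - x / b) @[x --> +oo] --> (0 : R).
Proof.
move=> b0; under eq_fun do rewrite expRD.
rewrite -(mulr0 (expR a)); apply: cvgMr.
apply: (cvg_comp (fun x => x / b) (fun x => expR (- x))); last exact: cvgr_expR.
by apply: gt0_cvgMly; rewrite ?invr_gt0.
Qed.

Lemma integral0y_expR_affine (a b : R) : 0 < b ->
  (\int[mu]_(x in `[0%R, +oo[) (expR (a - x / b))%:E = (b * expR a)%:E)%E.
Proof.
move=> b0; pose F := fun x => - b * expR (a - x / b).
have dF x : is_derive x (1 : R) F (expR (a - x / b)).
  have h := is_derive_expR_affine a b x.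
  apply: is_derive_eq; rewrite /GRing.scale /= mulrA mulrNN divff ?gt_eqF//.
  by rewrite mul1r ?mulr0 ?addr0.
rewrite (@ge0_integral_derive_itvcy _ F 0 0)//.
- by rewrite /F mul0r subr0 sub0r mulNr opprK.
- exact: is_derive_continuous (is_derive_expR_affine a b).
- by rewrite -(mulr0 (- b)); apply: cvgMr; exact: expR_affine_cvg0.
Qed.

(* The integrand has no closed antiderivative, but [g] below has: the term
   [- s ^+ 2 * normal_fun 0 s x] makes it exact, and the exponential [h] makes
   it nonnegative, as ge0_integral_derive_itvcy requires. *)
Lemma integral0y_sqr_normal_fun s : 0 < s ->
  (\int[mu]_(x in `[0%R, +oo[) (x ^+ 2 * normal_fun 0 s x)%:E =
   (s ^+ 2)%:E * \int[mu]_(x in `[0%R, +oo[) (normal_fun 0 s x)%:E)%E.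
Proof.
move=> s0; have s1 : s != 0 by rewrite gt_eqF.
pose h x := s ^+ 2 * expR (1 - x / s).
pose g x := (x ^+ 2 - s ^+ 2) * normal_fun 0 s x + h x.
pose F x := - s ^+ 2 * (x * normal_fun 0 s x) + - s * h x.
have cn : continuous (normal_fun 0 s).
  exact: is_derive_continuous (is_derive_normal_fun s).
have ch : continuous h.
  move=> x; apply: cvgMr.
  exact: is_derive_continuous (is_derive_expR_affine 1 s) x.
have cg : continuous g.
  move=> x; apply: cvgD; last exact: ch.
  apply: cvgM; last exact: cn.
  by apply: cvgB; [exact: exprn_continuous|exact: cvg_cst].
have dF x : is_derive x (1 : R) F (g x).
  have h1 := is_derive_normal_fun s x; have h2 := is_derive_expR_affine 1 s x.
  apply: is_derive_eq; rewrite /GRing.scale /= /g /h.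
  by field.
have h0 x : 0 <= h x by rewrite mulr_ge0 ?expR_ge0// sqr_ge0.
have n0 x := normal_fun_ge0 0 s x.
have g0 x : 0 <= x -> 0 <= g x.
  move=> x0; rewrite /g mulrBl addrAC -addrA addr_ge0//.
    by rewrite mulr_ge0// sqr_ge0.
  (* It remains that [h] dominates s^2 [normal_fun 0 s]. With y = x / s this is - y^2 / 2 <= 1 - y,
     a consequence of (y - 1)^2 >= 0. *)
  rewrite subr_ge0 /h ler_wpM2l ?sqr_ge0// /normal_fun subr0 ler_expR.
  have -> : - x ^+ 2 / (s ^+ 2 *+ 2) = - (x / s) ^+ 2 / 2.
    by rewrite -mulr_natr; field.
  by move: (x / s) => y; have := sqr_ge0 (y - 1); nra.
have mE (f : R -> R) : continuous f ->
    measurable_fun (`[0, +oo[%classic : set R) (fun x => (f x)%:E).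
  move=> cf; apply/measurable_EFinP/measurable_funTS.
  exact: continuous_measurable_fun.
have Ih : (\int[mu]_(x in `[0%R, +oo[) (h x)%:E = (s ^+ 3 * expR 1)%:E)%E.
  under eq_integral do rewrite EFinM.
  rewrite ge0_integralZl//.
  - by rewrite integral0y_expR_affine// -EFinM; congr EFin; ring.
  - apply: mE; exact: is_derive_continuous (is_derive_expR_affine 1 s).
  - by rewrite lee_fin sqr_ge0.
have Ig : (\int[mu]_(x in `[0%R, +oo[) (g x)%:E = (s ^+ 3 * expR 1)%:E)%E.
  rewrite (@ge0_integral_derive_itvcy g F 0 0)//.
  - by rewrite /F /h mul0r mulr0 add0r mul0r subr0; congr EFin; ring.
  - suff : F x @[x --> +oo] --> - s ^+ 2 * 0 + - s * (s ^+ 2 * 0).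
      by rewrite !mulr0 addr0.
    apply: cvgD; apply: cvgMr; first exact: mul_normal_fun_cvg0.
    by apply: cvgMr; exact: expR_affine_cvg0.
have cx : continuous (fun x => x ^+ 2 * normal_fun 0 s x).
  by move=> x; apply: cvgM; [exact: exprn_continuous|exact: cn].
have cs : continuous (fun x => s ^+ 2 * normal_fun 0 s x).
  by move=> x; apply: cvgMr; exact: cn.
have ID (f1 f2 : R -> R) : (forall x, 0 <= x -> 0 <= f1 x) ->
    (forall x, 0 <= x -> 0 <= f2 x) -> continuous f1 -> continuous f2 ->
    (\int[mu]_(x in `[0%R, +oo[) (f1 x + f2 x)%:E =
     \int[mu]_(x in `[0%R, +oo[) (f1 x)%:E +
     \int[mu]_(x in `[0%R, +oo[) (f2 x)%:E)%E.
  move=> f10 f20 cf1 cf2; under eq_integral do rewrite EFinD.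
  apply: ge0_integralD; rewrite //=.
  - by move=> x; rewrite in_itv /= andbT lee_fin => /f10.
  - exact: mE.
  - by move=> x; rewrite in_itv /= andbT lee_fin => /f20.
  - exact: mE.
(* Pointwise x^2 f + h = s^2 f + g, where f is [normal_fun 0 s]. As [h] and [g] have the same finite
   integral, it can be cancelled. *)
have : (\int[mu]_(x in `[0%R, +oo[) (x ^+ 2 * normal_fun 0 s x)%:E
        + (s ^+ 3 * expR 1)%:E =
  \int[mu]_(x in `[0%R, +oo[) (s ^+ 2 * normal_fun 0 s x)%:E
        + (s ^+ 3 * expR 1)%:E)%E.
  have sq0 (a x : R) : 0 <= a ^+ 2 * normal_fun 0 s x.
    by rewrite mulr_ge0 ?sqr_ge0.
  rewrite -[in LHS]Ih -[in RHS]Ig -(ID _ _ (fun x _ => sq0 x x) (fun x _ => h0 x) cx ch).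
  rewrite -(ID _ _ (fun x _ => sq0 s x) g0 cs cg).
  by apply: eq_integral => x _; congr EFin; rewrite /g; ring.
move=> /(congr1 (fun z => z - (s ^+ 3 * expR 1)%:E)%E); rewrite !addeK// => ->.
under eq_integral do rewrite EFinM.
rewrite ge0_integralZl//.
- exact: mE.
- by move=> x _; rewrite lee_fin n0.
- by rewrite lee_fin sqr_ge0.
Qed.

Lemma continuous_normal_fun s : continuous (normal_fun 0 s).
Proof. exact: is_derive_continuous (is_derive_normal_fun s). Qed.

Lemma normal_fun_even s : normal_fun 0 s =1 normal_fun 0 s \o -%R.
Proof. by move=> x; rewrite /normal_fun /= !subr0 sqrrN. Qed.

(** Both x^2 f and f are even, so the half-line identity extends to the whole line; the total mass 1
    of the density then fixes the constant. *)
Lemma integral_sqr_normal_pdf s : 0 < s ->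
  (\int[mu]_x (x ^+ 2 * normal_pdf 0 s x)%:E = (s ^+ 2)%:E)%E.
Proof.
move=> s0; have s1 : s != 0 by rewrite gt_eqF.
have p0 := normal_peak_ge0 s.
have cn := @continuous_normal_fun s.
have mE (f : R -> R) : continuous f ->
    measurable_fun setT (fun x => (f x)%:E).
  by move=> cf; apply/measurable_EFinP; exact: continuous_measurable_fun.
have cx : continuous (fun x => x ^+ 2 * normal_fun 0 s x).
  by move=> x; apply: cvgM; [exact: exprn_continuous|exact: cn].
have E1 : (\int[mu]_x (x ^+ 2 * normal_fun 0 s x)%:E =
    (s ^+ 2)%:E * \int[mu]_x (normal_fun 0 s x)%:E)%E.
  have x0 x : 0 <= x ^+ 2 * normal_fun 0 s x.
    by rewrite mulr_ge0 ?sqr_ge0 ?normal_fun_ge0.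
  rewrite (ge0_symfun_integralT x0 cx); last first.
    by move=> x; rewrite fctE /= sqrrN [in LHS]normal_fun_even.
  rewrite -set_itvcy integral0y_sqr_normal_fun// muleCA; congr (_ * _)%E.
  rewrite set_itvcy (ge0_symfun_integralT (normal_fun_ge0 0 s) cn)//.
  exact: normal_fun_even.
have := integral_normal_pdf 0 s; rewrite normal_pdfE//.
under eq_integral do rewrite EFinM.
rewrite ge0_integralZl//; last 2 first.
- exact: mE.
- by move=> x _; rewrite lee_fin normal_fun_ge0.
move=> E2; under eq_integral do rewrite mulrCA EFinM.
rewrite ge0_integralZl//; last 2 first.
- exact: mE.
- by move=> x _; rewrite lee_fin mulr_ge0 ?sqr_ge0 ?normal_fun_ge0.
by rewrite E1 muleCA E2 mule1.
Qed.

(** The density is invariant under x -> - x, which exchanges the two parts. This is what makes the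
    mean of a centred normal variable vanish. *)
Lemma integral_normal_pdf_pos_neg s : 0 < s ->
  (\int[mu]_x (Num.max x 0 * normal_pdf 0 s x)%:E =
   \int[mu]_x (Num.max (- x) 0 * normal_pdf 0 s x)%:E)%E.
Proof.
move=> s0; have s1 : s != 0 by rewrite gt_eqF.
have cG : continuous (fun x => Num.max x 0 * normal_pdf 0 s x).
  move=> x; apply: cvgM; last exact: continuous_normal_pdf.
  by apply: continuous_max => //; exact: cst_continuous.
set G := fun x => _ in cG.
transitivity (\int[mu]_(x in `[0%R, +oo[) (G x)%:E)%E.
  rewrite [RHS]integral_mkcond; apply: eq_integral => x _; rewrite patchE.
  rewrite mem_setE in_itv /= andbT; case: ifPn => // x0.
  by rewrite /G max_r ?mul0r// ltW// ltNge.
(* The bound is written [- 0] to match the interval in the reflection substitution. *)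
transitivity (\int[mu]_(x in `]-oo, (- 0)%R]) ((G \o -%R) x)%:E)%E.
  rewrite (@ge0_integration_by_substitutionNy R (G \o -%R) 0).
  - by apply: eq_integral => x _; rewrite /= opprK.
  - apply: continuous_subspaceT => x; apply: continuous_comp; last exact: cG.
    exact: opp_continuous.
  - move=> x _; rewrite /G /= mulr_ge0 ?normal_pdf_ge0//.
    by rewrite le_max lexx orbT.
rewrite integral_mkcond; apply: eq_integral => x _; rewrite patchE.
rewrite mem_setE in_itv /= oppr0 /G /=.
have -> : normal_pdf 0 s (- x) = normal_pdf 0 s x.
  by rewrite normal_pdfE//= [in RHS]normal_fun_even.
by case: ifPn => // x0; rewrite max_r ?mul0r// oppr_le0 ltW// ltNge.
Qed.

End normal_moments.

(** * Independence and second moments *)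

Section independence.
Context {d : measure_display} {Om : measurableType d} {R : realType}.
Variable P : probability Om R.

Lemma mutually_independent_pair (I : choiceType) (D : set I)
    (G : I -> set_system Om) (i j : I) (A B : set Om) :
  mutually_independent P D G -> D i -> D j -> i != j -> G i A -> G j B ->
  P (A `&` B) = (P A * P B)%E.
Proof.
move=> PG Di Dj ij GA GB.
pose E k := if k == i then A else B.
have Ei : E i = A by rewrite /E eqxx.
have Ej : E j = B by rewrite /E eq_sym (negbTE ij).
have := PG [fset i; j]%fset E.
rewrite big_fsetU1 ?inE//= big_seq_fset1 Ei Ej => <-.
- congr (P _); apply/seteqP; split=> [w [Aw Bw] k|w Ew].
    by rewrite /= !inE => /orP[] /eqP ->; rewrite ?Ei ?Ej.
  by split; [rewrite -Ei|rewrite -Ej]; apply: Ew; rewrite /= !inE eqxx ?orbT.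
- by move=> k; rewrite /= !inE => /orP[] /eqP ->.
- by move=> k; rewrite /= !inE => /orP[] /eqP ->; rewrite ?Ei ?Ej.
Qed.

Definition independent_rv (X Y : Om -> R) := forall A B : set R,
  measurable A -> measurable B ->
  P (X @^-1` A `&` Y @^-1` B) = (P (X @^-1` A) * P (Y @^-1` B))%E.

(** By independence the joint law of (X, Y) agrees with the product of the marginal laws on
    rectangles, hence on all measurable sets; Fubini then factors the integral of the product.
    Square integrability makes the product integrable. *)
Lemma expectation_independentM (X Y : {RV P >-> R}) :
  (X : Om -> R) \in Lfun P 2%:E -> (Y : Om -> R) \in Lfun P 2%:E ->
  independent_rv X Y -> ('E_P[X \* Y] = 'E_P[X] * 'E_P[Y])%E.
Proof.
move=> X2 Y2 XY.
have Pfin : P setT \is a fin_num by rewrite probability_setT.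
have X1 := Lfun_subset12 Pfin X2. have Y1 := Lfun_subset12 Pfin Y2.
have XY1 := Lfun2_mul_Lfun1 X2 Y2.
pose phi w := (X w, Y w).
have mphi : measurable_fun setT phi by exact: measurable_fun_pair.
pose mphi_mixin := isMeasurableFun.Build _ _ _ _ _ mphi.
pose Z : {mfun Om >-> (R * R)%type} := HB.pack phi mphi_mixin.
have mf : measurable_fun setT (fun z : R * R => (z.1 * z.2)%:E).
  by apply/measurable_EFinP; apply: measurable_funM.
rewrite !unlock.
transitivity (\int[distribution P Z]_z (z.1 * z.2)%:E)%E.
  rewrite integral_pushforward//; exact/Lfun1_integrable.
have prodE (C : set (R * R)) : measurable C ->
    (distribution P X \x distribution P Y)%E C = distribution P Z C.
  move=> mC; apply: (@product_measure_unique _ _ _ _ _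
    (distribution P X) (distribution P Y) (distribution P Z)) => // A B mA mB.
(* Fubini needs integrability for the product measure; it is transferred from the joint law, the two
   measures being equal. *)
have intf : (distribution P X \x distribution P Y)%E.-integrable setT
    (fun z : R * R => (z.1 * z.2)%:E).
  have /integrableP[_ fZ] : (distribution P Z).-integrable setT
      (fun z : R * R => (z.1 * z.2)%:E).
    by apply: integrable_pushforward => //; exact/Lfun1_integrable.
  apply/integrableP; split => //; apply: le_lt_trans fZ.
  rewrite le_eqVlt; apply/orP; left; apply/eqP.
  by apply: eq_measure_integral => C mC _; exact: prodE.
transitivity (\int[(distribution P X \x distribution P Y)%E]_z (z.1 * z.2)%:E)%E.
  by apply: eq_measure_integral => C mC _; exact/esym/prodE.
rewrite -integral12_prod_meas1// /fubini_F /=.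
have IY : (\int[distribution P Y]_y y%:E = \int[P]_w (Y w)%:E)%E.
  rewrite integral_distribution//; exact/Lfun1_integrable.
have IX : (\int[distribution P X]_y y%:E = \int[P]_w (X w)%:E)%E.
  rewrite integral_distribution//; exact/Lfun1_integrable.
rewrite -IX -IY.
have IYfin : (\int[distribution P Y]_y y%:E \is a fin_num)%E.
  by rewrite IY integrable_fin_num//; exact/Lfun1_integrable.
transitivity (\int[distribution P X]_x (x%:E * \int[distribution P Y]_y y%:E))%E.
  apply: eq_integral => x _; under eq_integral do rewrite EFinM.
  rewrite integralZl//.
  by apply: integrable_pushforward => //; exact/Lfun1_integrable.
rewrite -(fineK IYfin) integralZr//.
by apply: integrable_pushforward => //; exact/Lfun1_integrable.
Qed.

Lemma expectation_quadratic (I : finType) (X : I -> Om -> R) (s : I -> R)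
    (c : I -> I -> R) :
  (forall i, X i \in Lfun P 2%:E) ->
  (forall i j, 'E_P[X i \* X j] = (if i == j then s i else 0)%:E)%E ->
  ('E_P[fun w => (\sum_i \sum_j c i j * (X i w * X j w))%R] =
  (\sum_i c i i * s i)%R%:E)%E.
Proof.
move=> X2 XX.
have XX1 i j : P.-integrable setT (fun w => (X i w * X j w)%:E).
  exact/Lfun1_integrable/Lfun2_mul_Lfun1.
have cXX i j : P.-integrable setT (fun w => (c i j * (X i w * X j w))%:E).
  have := integrableZl measurableT (c i j) (XX1 i j).
  by under eq_fun do rewrite -EFinM.
have IXX i j : (\int[P]_w (c i j * (X i w * X j w))%:E =
    (c i j * (if i == j then s i else 0))%:E)%E.
  under eq_integral do rewrite EFinM.
  by rewrite integralZl//; have := XX i j; rewrite unlock => ->; rewrite -EFinM.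
rewrite unlock.
transitivity (\int[P]_w \sum_i \sum_j (c i j * (X i w * X j w))%:E)%E.
  apply: eq_integral => w _; rewrite -sumEFin; apply: eq_bigr => i _.
  by rewrite -sumEFin.
rewrite integral_sum//; last by move=> i; exact: integrable_sum.
rewrite -sumEFin; apply: eq_bigr => i _.
rewrite integral_sum// (bigD1 i)//= big1 ?adde0 ?IXX ?eqxx// => j ji.
by rewrite IXX eq_sym (negbTE ji) mulr0.
Qed.

Definition normal_rv (s : R) (X : Om -> R) := measurable_fun setT X /\
  forall B : set R, measurable B -> P (X @^-1` B) = normal_prob 0 s B.

Lemma ge0_integral_normal_rv (s : R) (X : Om -> R) (g : R -> R) :
  normal_rv s X -> (forall x, 0 <= g x) -> measurable_fun setT g ->
  (\int[P]_w (g (X w))%:E =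
   \int[lebesgue_measure]_x (g x * normal_pdf 0 s x)%:E)%E.
Proof.
move=> [mX PX] g0 mg.
(* normal_prob is a measure on measurableTypeR R, which is only convertible to
   the canonical measurable type on R. *)
have mX' : @measurable_fun _ _ Om (measurableTypeR R) setT X by exact: mX.
have mg' : @measurable_fun _ _ (measurableTypeR R) R setT g by exact: mg.
pose mmX := isMeasurableFun.Build _ _ _ _ _ mX'.
pose X' : {RV P >-> measurableTypeR R} := HB.pack (X : Om -> measurableTypeR R) mmX.
transitivity (\int[distribution P X']_x (g x)%:E)%E.
  by rewrite ge0_integral_distribution//; exact/measurable_EFinP.
transitivity (\int[normal_prob 0 s]_x (g x)%:E)%E.
  by apply: eq_measure_integral => B mB _; exact: PX.
by rewrite ge0_integral_normal_prob//; exact/measurable_EFinP.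
Qed.

Lemma normal_rv_second_moment (s : R) (X : Om -> R) : 0 < s -> normal_rv s X ->
  ('E_P[X \* X] = (s ^+ 2)%:E)%E.
Proof.
move=> s0 nX; rewrite unlock -(integral_sqr_normal_pdf s0).
rewrite -(@ge0_integral_normal_rv s X (fun x => x ^+ 2) nX)//.
- by move=> x; exact: sqr_ge0.
Qed.

Lemma normal_rv_Lfun2 (s : R) (X : Om -> R) : 0 < s -> normal_rv s X ->
  X \in Lfun P 2%:E.
Proof.
move=> s0 nX; have [mX _] := nX.
rewrite inE; apply/andP; split; rewrite inE//= /finite_norm unlock poweR_lty//=.
apply: (@le_lt_trans _ _ (\int[P]_w (X w * X w)%:E)%E).
  rewrite le_eqVlt; apply/orP; left; apply/eqP; apply: eq_integral => w _.
  by rewrite powR_mulrn//= -expr2 real_normK// num_real.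
by have := normal_rv_second_moment s0 nX; rewrite unlock => ->; rewrite ltry.
Qed.

Lemma normal_rv_expectation (s : R) (X : Om -> R) : 0 < s -> normal_rv s X ->
  ('E_P[X] = 0)%E.
Proof.
move=> s0 nX; have [mX _] := nX; rewrite unlock integralE.
have intX : P.-integrable setT (fun w => (X w)%:E).
  apply/Lfun1_integrable.
  have Pfin : P setT \is a fin_num by rewrite probability_setT.
  exact: (Lfun_subset12 Pfin (normal_rv_Lfun2 s0 nX)).
(* Finiteness is what makes the difference of the two equal parts 0. *)
have fin : (\int[P]_w (fun w => (X w)%:E)^\- w \is a fin_num)%E.
  by apply: integrable_fin_num => //; exact: integrable_funeneg.
suff -> : (\int[P]_w (fun w => (X w)%:E)^\+ w =
           \int[P]_w (fun w => (X w)%:E)^\- w)%E by rewrite subee.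
have -> : (\int[P]_w (fun w => (X w)%:E)^\+ w = \int[P]_w (Num.max (X w) 0)%:E)%E.
  by apply: eq_integral => w _; rewrite funeposE -EFin_max.
have -> : (\int[P]_w (fun w => (X w)%:E)^\- w = \int[P]_w (Num.max (- X w) 0)%:E)%E.
  by apply: eq_integral => w _; rewrite funenegE -EFinN -EFin_max.
rewrite (@ge0_integral_normal_rv s X (fun x => Num.max x 0))//; last 2 first.
- by move=> x; rewrite le_max lexx orbT.
- exact: measurable_maxr.
rewrite (@ge0_integral_normal_rv s X (fun x => Num.max (- x) 0))//; last 2 first.
- by move=> x; rewrite le_max lexx orbT.
- by apply: measurable_maxr => //; exact: measurableT_comp.
exact: integral_normal_pdf_pos_neg.
Qed.

Lemma expectation_normal_rvM (s s' : R) (X Y : Om -> R) : 0 < s -> 0 < s' ->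
  normal_rv s X -> normal_rv s' Y -> independent_rv X Y -> ('E_P[X \* Y] = 0)%E.
Proof.
move=> s0 s'0 nX nY XY.
have [mX _] := nX; have [mY _] := nY.
pose mmX := isMeasurableFun.Build _ _ _ _ _ mX.
pose X' : {RV P >-> R} := HB.pack X mmX.
pose mmY := isMeasurableFun.Build _ _ _ _ _ mY.
pose Y' : {RV P >-> R} := HB.pack Y mmY.
rewrite (@expectation_independentM X' Y')//.
- by rewrite (normal_rv_expectation s0 nX) mul0e.
- exact: normal_rv_Lfun2 s0 nX.
- exact: normal_rv_Lfun2 s'0 nY.
Qed.

Definition sqmod (x : R[i]) : R := complex.Re x ^+ 2 + complex.Im x ^+ 2.

(** Same convention as in [coord]: [true] selects the imaginary part. *)
Definition part (b : bool) (x : R[i]) : R :=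
  if b then complex.Im x else complex.Re x.

(* cj marks the variables that enter conjugated: the channel estimate involves
   the conjugate of the received signal, hence of the noise. *)
Lemma expectation_sqmod_linear (J : finType) (W : J -> Om -> R[i])
    (cj : pred J) (s : J -> R) (a : J -> R[i]) :
  (forall j b, part b \o W j \in Lfun P 2%:E) ->
  (forall j b k c, 'E_P[(part b \o W j) \* (part c \o W k)] =
    (if (j, b) == (k, c) then s j else 0)%:E)%E ->
  ('E_P[fun w => sqmod
     (\sum_j a j * (if cj j then (W j w)^*%C else W j w))%R] =
   (2 * \sum_j sqmod (a j) * s j)%R%:E)%E.
Proof.
move=> W2 WW.
(* [sg] is the sign that conjugation puts on imaginary parts. The real and imaginary parts of the
   sum are the real linear forms in the coordinates [X] with coefficients [u] and [v]. *)
pose sg j : R := if cj j then -1 else 1.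
have sg2 j : sg j ^+ 2 = 1 by rewrite /sg; case: ifP; rewrite ?sqrrN expr1n.
pose u (jb : J * bool) := if jb.2 then - sg jb.1 * complex.Im (a jb.1)
                          else complex.Re (a jb.1).
pose v (jb : J * bool) := if jb.2 then sg jb.1 * complex.Re (a jb.1)
                          else complex.Im (a jb.1).
pose X (jb : J * bool) := part jb.2 \o W jb.1.
have term j w : a j * (if cj j then (W j w)^*%C else W j w) =
    (\sum_(b : bool) u (j, b) * X (j, b) w) +i*
    (\sum_(b : bool) v (j, b) * X (j, b) w).
  rewrite !big_bool /u /v /X /sg /=.
  case: (a j) (W j w) => [p q] [x y]; case: ifP => _ /=; simpc;
    by congr (_ +i* _); ring.
have sumE (F G : J -> R) :
    \sum_j (F j +i* G j) = (\sum_j F j) +i* (\sum_j G j).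
  by elim/big_rec3: _ => // j x y z _ ->; simpc.
rewrite [X in ('E_P[X])%E](_ : _ = fun w => \sum_jb \sum_jc
    (u jb * u jc + v jb * v jc) * (X jb w * X jc w)); last first.
  apply/funext => w; under [in LHS]eq_bigr do rewrite term.
  have pairE (t : J * bool -> R) : \sum_j \sum_b t (j, b) * X (j, b) w =
      \sum_jb t jb * X jb w.
    by rewrite pair_bigA; apply: eq_bigr => -[].
  rewrite sumE /sqmod /= !pairE.
  have E (t : J * bool -> R) : (\sum_jb t jb * X jb w) ^+ 2 =
      \sum_jb \sum_jc t jb * t jc * (X jb w * X jc w).
    rewrite expr2 big_distrlr /=; apply: eq_bigr => jb _; apply: eq_bigr => jc _.
    by ring.
  rewrite !E -big_split; apply: eq_bigr => jb _; rewrite -big_split.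
  by apply: eq_bigr => jc _; rewrite mulrDl.
rewrite (@expectation_quadratic _ X (fun jb => s jb.1)).
(* For either value of [b], u^2 + v^2 is [sqmod (a j)], because sg^2 = 1; the two values of [b] give
   the factor 2. *)
- congr EFin; rewrite -(pair_bigA _ (fun j b =>
    (u (j, b) * u (j, b) + v (j, b) * v (j, b)) * s j)) /= mulr_sumr.
  apply: eq_bigr => j _; rewrite big_bool /u /v /= /sqmod.
  rewrite (_ : - sg j * _ * _ = sg j ^+ 2 * complex.Im (a j) ^+ 2); last by ring.
  rewrite (_ : sg j * _ * _ = sg j ^+ 2 * complex.Re (a j) ^+ 2); last by ring.
  by rewrite sg2; ring.
- by move=> jb; exact: W2.
- by move=> [j b] [k c]; rewrite WW.
Qed.

End independence.

(** * The real Frobenius inner product *)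

Section real_inner_product.
Context {R : realType}.
Local Notation C := R[i].

Lemma adjmxM m n p (A : 'M[C]_(m, n)) (B : 'M[C]_(n, p)) :
  (A *m B)^t* = B^t* *m A^t*.
Proof. by rewrite trmx_mul map_mxM. Qed.

Lemma adjmxD m n (A B : 'M[C]_(m, n)) : (A + B)^t* = A^t* + B^t*.
Proof. by rewrite raddfD /= map_mxD. Qed.

Lemma adjmxN m n (A : 'M[C]_(m, n)) : (- A)^t* = - A^t*.
Proof. by rewrite raddfN /= map_mxN. Qed.

Lemma adjmx_real_scalar n (s : R) : ((s%:C)%:M : 'M[C]_n)^t* = (s%:C)%:M.
Proof. by rewrite tr_scalar_mx map_scalar_mx; congr (_%:M); exact: conjc_real. Qed.

Lemma adjmx_inv n (A : 'M[C]_n) : (invmx A)^t* = invmx (A^t*).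
Proof. by rewrite trmx_inv map_invmx. Qed.

(** Taking the real part makes the form symmetric and R-bilinear, so squared norms expand as real
    polynomials. *)
Definition rdot m n (A B : 'M[C]_(m, n)) : R := complex.Re (\tr (A *m B^t*)).

Lemma rdotDl m n (A B E : 'M[C]_(m, n)) : rdot (A + B) E = rdot A E + rdot B E.
Proof. by rewrite /rdot mulmxDl mxtraceD raddfD. Qed.

Lemma ReJ (x : C) : complex.Re x^*%C = complex.Re x.
Proof. by case: x. Qed.

Lemma rdotC m n (A B : 'M[C]_(m, n)) : rdot A B = rdot B A.
Proof.
rewrite /rdot -(ReJ (\tr (B *m A^t*))).
have -> : ((\tr (B *m A^t*))^*)%C = \tr ((B *m A^t*)^t*).
  by rewrite trace_map_mx mxtrace_tr.
by rewrite adjmxM trmxCK.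
Qed.

Lemma rdotNl m n (A E : 'M[C]_(m, n)) : rdot (- A) E = - rdot A E.
Proof. by rewrite /rdot mulNmx raddfN raddfN. Qed.

Lemma rdotZl m n (a : R) (A E : 'M[C]_(m, n)) : rdot (a%:C *: A) E = a * rdot A E.
Proof.
rewrite /rdot -scalemxAl mxtraceZ; case: (\tr _) => x y.
by simpc.
Qed.

Lemma rdotDr m n (A B E : 'M[C]_(m, n)) : rdot E (A + B) = rdot E A + rdot E B.
Proof. by rewrite !(rdotC E) rdotDl. Qed.

Lemma rdotNr m n (A E : 'M[C]_(m, n)) : rdot E (- A) = - rdot E A.
Proof. by rewrite !(rdotC E) rdotNl. Qed.

Lemma rdotZr m n (a : R) (A E : 'M[C]_(m, n)) : rdot E (a%:C *: A) = a * rdot E A.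
Proof. by rewrite !(rdotC E) rdotZl. Qed.

Lemma rdot0l m n (E : 'M[C]_(m, n)) : rdot 0 E = 0.
Proof. by rewrite /rdot mul0mx mxtrace0. Qed.

Lemma rdot_suml m n (I : Type) (r : seq I) (P : pred I) (F : I -> 'M[C]_(m, n)) E :
  rdot (\sum_(i <- r | P i) F i) E = \sum_(i <- r | P i) rdot (F i) E.
Proof.
by elim/big_rec2: _ => [|i x A _ <-]; rewrite ?rdot0l ?rdotDl.
Qed.

Lemma rdotMl m n p (M : 'M[C]_(m, n)) (A : 'M[C]_(n, p)) (B : 'M[C]_(m, p)) :
  rdot (M *m A) B = rdot A (M^t* *m B).
Proof. by rewrite /rdot adjmxM trmxCK -mulmxA mxtrace_mulC mulmxA. Qed.

Lemma rdotMr m n p (M : 'M[C]_(n, p)) (A : 'M[C]_(m, n)) (B : 'M[C]_(m, p)) :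
  rdot (A *m M) B = rdot A (B *m M^t*).
Proof. by rewrite /rdot adjmxM trmxCK mulmxA. Qed.

Lemma rdotE m n (A B : 'M[C]_(m, n)) : rdot A B =
  \sum_i \sum_j (complex.Re (A i j) * complex.Re (B i j) +
                 complex.Im (A i j) * complex.Im (B i j)).
Proof.
rewrite /rdot /mxtrace raddf_sum; apply: eq_bigr => i _ /=.
rewrite mxE raddf_sum; apply: eq_bigr => j _ /=.
by rewrite !mxE; case: (A i j) (B i j) => [x y] [z w] /=; ring.
Qed.

Lemma rdot_ge0 m n (A : 'M[C]_(m, n)) : 0 <= rdot A A.
Proof.
rewrite rdotE; apply: sumr_ge0 => i _; apply: sumr_ge0 => j _.
by rewrite addr_ge0 // -expr2 sqr_ge0.
Qed.

Lemma rdot_eq0 m n (A : 'M[C]_(m, n)) : (rdot A A == 0) = (A == 0).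
Proof.
have ge0 (x : C) : 0 <= complex.Re x * complex.Re x + complex.Im x * complex.Im x.
  by rewrite -!expr2 addr_ge0 ?sqr_ge0.
apply/eqP/eqP => [|->]; last by rewrite rdot0l.
rewrite rdotE => /eqP; rewrite psumr_eq0; last first.
  by move=> i _; apply: sumr_ge0.
move=> /allP h; apply/matrixP => i j; rewrite mxE.
have := h i (mem_index_enum _); rewrite psumr_eq0//= => /allP.
move=> /(_ j (mem_index_enum _)) /=.
rewrite paddr_eq0 -?expr2 ?sqr_ge0// !sqrf_eq0.
by case: (A i j) => x y /= /andP[/eqP -> /eqP ->].
Qed.

Lemma enorm_sqr n (v : 'cV[C]_n) : enorm v ^+ 2 = rdot v v.
Proof.
rewrite /enorm rdotE sqr_sqrtr; last first.
  by apply: sumr_ge0 => i _; rewrite addr_ge0 ?sqr_ge0.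
by apply: eq_bigr => i _; rewrite big_ord1 !expr2.
Qed.

Lemma enorm_sqrD n (v w : 'cV[C]_n) :
  enorm (v + w) ^+ 2 = enorm v ^+ 2 + 2 * rdot v w + enorm w ^+ 2.
Proof.
rewrite !enorm_sqr rdotDl !rdotDr (rdotC w v) addrA mulr_natl mulr2n.
by rewrite !addrA.
Qed.

Lemma rdot_col n (v w : 'cV[C]_n) : complex.Re ((v^t* *m w) 0 0) = rdot w v.
Proof. by rewrite /rdot mxtrace_mulC /mxtrace big_ord1. Qed.

Lemma rdot_rank1r m n (M : 'M[C]_(m, n)) (v : 'cV[C]_m) (w : 'cV[C]_n) :
  rdot M (v *m w^t*) = rdot (M *m w) v.
Proof. by rewrite rdotMr. Qed.

Lemma adjmx_col_mul_real n (v : 'cV[C]_n) : v^t* *m v = ((enorm v ^+ 2)%:C)%:M.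
Proof.
rewrite [LHS]mx11_scalar; congr (_%:M).
rewrite enorm_sqr rdotE mxE rmorph_sum; apply: eq_bigr => i _ /=.
rewrite big_ord1 !mxE; case: (v i 0) => x y; rewrite /= /Num.conj /=; simpc.
by congr (_ +i* _); ring.
Qed.

Lemma rdot_rank1 m n (v : 'cV[C]_m) (w : 'cV[C]_n) :
  rdot (v *m w^t*) (v *m w^t*) = enorm v ^+ 2 * enorm w ^+ 2.
Proof.
rewrite rdot_rank1r -mulmxA adjmx_col_mul_real mul_mx_scalar rdotZl enorm_sqr.
by rewrite mulrC -enorm_sqr.
Qed.

(** Bias-variance decomposition: the spread of the [w i] about their mean [e] does not depend on the
    shift [c]. For w_j = xhat - x_j that spread is delta. *)
Lemma enorm_sqr_mean n (I : finType) (p : I -> R) (w : I -> 'cV[C]_n)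
    (c : 'cV[C]_n) : \sum_i p i = 1 ->
  let e := \sum_i (p i)%:C *: w i in
  \sum_i p i * enorm (w i + c) ^+ 2 =
  \sum_i p i * enorm (w i) ^+ 2 - enorm e ^+ 2 + enorm (e + c) ^+ 2.
Proof.
move=> p1 e; rewrite enorm_sqrD.
under eq_bigr do rewrite enorm_sqrD !mulrDr.
rewrite !big_split /= -[X in _ + _ + X]mulr_suml p1 mul1r.
have -> : \sum_i p i * (2 * rdot (w i) c) = 2 * rdot e c.
  rewrite /e rdot_suml mulr_sumr; apply: eq_bigr => i _.
  by rewrite rdotZl; ring.
by ring.
Qed.
End real_inner_product.

(** * The mean square error and its rank-one update *)

Section mean_square_error.
Context {R : realType}.
Local Notation C := R[i].

Section regularized_gram.
Variables (s : R) (n p : nat) (Y : 'M[C]_(n, p)).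
Hypothesis s_gt0 : 0 < s.
Let G := Y *m Y^t* + (s%:C)%:M.

Lemma regularized_gram_adj : G^t* = G.
Proof. by rewrite adjmxD adjmxM trmxCK adjmx_real_scalar. Qed.

Lemma rdot_regularized_gram m (v : 'M[C]_(n, m)) :
  rdot (G *m v) v = rdot (Y^t* *m v) (Y^t* *m v) + s * rdot v v.
Proof. by rewrite mulmxDl rdotDl -mulmxA rdotMl mul_scalar_mx rdotZl. Qed.

(** [G] is positive definite: G v = 0 would give |Y^H v|^2 + s |v|^2 = 0, hence v = 0. *)
Lemma regularized_gram_unit : G \in unitmx.
Proof.
rewrite -row_free_unit; apply: inj_row_free => v vG.
have Gv : G *m v^t* = 0.
  by rewrite -regularized_gram_adj -adjmxM vG trmx0 map_mx0.
have := rdot_regularized_gram (v^t*); rewrite Gv rdot0l => /esym /eqP.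
rewrite paddr_eq0 ?rdot_ge0 ?mulr_ge0 ?rdot_ge0 ?(ltW s_gt0)// => /andP[_].
rewrite mulf_eq0 gt_eqF//= rdot_eq0 => /eqP v0.
by rewrite -(trmxCK v) v0 trmx0 map_mx0.
Qed.

(** With w = G^-1 v, the quantity is w^H G w >= s |w|^2, and w is nonzero. *)
Lemma rdot_invmx_regularized_gram_gt0 (v : 'cV[C]_n) : v != 0 ->
  0 < rdot v (invmx G *m v).
Proof.
move=> v0; have U := regularized_gram_unit.
rewrite -{1}(mulKVmx U v) rdot_regularized_gram.
rewrite ltr_wpDl ?rdot_ge0// mulr_gt0// lt_neqAle rdot_ge0 andbT eq_sym rdot_eq0.
by apply: contra v0 => /eqP v0; rewrite -(mulKVmx U v) v0 mulmx0.
Qed.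

End regularized_gram.

(* Tr C_e for G = Xhat Xhat^H + s I and D = Xhat (Xhat - X)^H + s I: the second
   summand is s |G^-1 Xhat|^2, with Xhat Xhat^H replaced by G - s I. *)
Definition mse (s : R) n (G D : 'M[C]_n) : R :=
  rdot (invmx G *m D) (invmx G *m D) +
  s * (complex.Re (\tr (invmx G)) - s * rdot (invmx G) (invmx G)).

Lemma invmx_unique n (A B : 'M[C]_n) : A *m B = 1%:M -> invmx A = B.
Proof.
move=> AB; have [UA _] := mulmx1_unit AB.
by rewrite -[B](mulKmx UA) AB mulmx1.
Qed.

Section rank1_update.
Variables (n : nat) (G : 'M[C]_n) (x : 'cV[C]_n).
Hypotheses (G_unit : G \in unitmx) (G_adj : G^t* = G).
Let Q := invmx G.
Let t := Q *m x.
Let alpha := rdot x t.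
Let k := (1 + alpha)^-1.
Hypothesis alpha_neq : 1 + alpha != 0.

Let Q_adj : Q^t* = Q. Proof. by rewrite adjmx_inv G_adj. Qed.

Let alphaE : x^t* *m t = (alpha%:C)%:M.
Proof.
rewrite [LHS]mx11_scalar; congr (_%:M).
(* The scalar x^H Q x is its own adjoint, hence real, so taking the real part in [alpha] loses
   nothing. *)
have h : (x^t* *m t)^t* = x^t* *m t.
  by rewrite adjmxM trmxCK adjmxM Q_adj mulmxA.
have : complex.Im ((x^t* *m t) 0 0) = 0.
  move/matrixP/(_ 0 0): h; rewrite 2!mxE; case: ((x^t* *m t) 0 0) => a b [] /=.
  by move=> /eqP; rewrite eqNr => /eqP.
rewrite /alpha rdotC -rdot_col; case: ((x^t* *m t) 0 0) => a b /= ->.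
by [].
Qed.

Let tadjx : t^t* *m x = (alpha%:C)%:M.
Proof. by rewrite adjmxM Q_adj -mulmxA alphaE. Qed.

(** Sherman-Morrison formula, checked by multiplying out: the coefficients of x t^H add up to 1 - k
    (1 + alpha) = 0. *)
Lemma invmx_rank1_update :
  invmx (G + x *m x^t*) = Q - k%:C *: (t *m t^t*).
Proof.
have Gt : G *m (t *m t^t*) = x *m t^t* by rewrite mulmxA mulKVmx.
have xQ : x *m x^t* *m Q = x *m t^t* by rewrite -mulmxA adjmxM Q_adj.
have xt : x *m x^t* *m (t *m t^t*) = alpha%:C *: (x *m t^t*).
  by rewrite mulmxA -(mulmxA x) alphaE mul_mx_scalar -scalemxAl.
apply: invmx_unique; rewrite mulmxDl !mulmxBr mulmxV// -!scalemxAr Gt xQ xt.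
rewrite scalerA -addrA -[RHS]addr0; congr (_ + _).
rewrite addrCA -opprD -scalerDl -{1}(scale1r (x *m _)) -scalerBl.
rewrite (_ : 1 - _ = 0) ?scale0r//.
rewrite -rmorphM -rmorphD -(rmorph1 (real_complex R)) -rmorphB.
rewrite -(rmorph0 (real_complex R)); by congr (_%:C); rewrite /k; field.
Qed.

(** The updated inverse sends x to k t, because 1 - k alpha = k. Hence the change of Q D again has
    rank one, with left factor t. *)
Lemma rank1_update_mul (D : 'M[C]_n) (w : 'cV[C]_n) :
  invmx (G + x *m x^t*) *m (D + x *m w^t*) =
  Q *m D + k%:C *: (t *m (w - D^t* *m t)^t*).
Proof.
rewrite invmx_rank1_update mulmxDr.
have -> : (Q - k%:C *: (t *m t^t*)) *m (x *m w^t*) = k%:C *: (t *m w^t*).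
  rewrite mulmxA mulmxBl -scalemxAl -mulmxA tadjx mul_mx_scalar scalerA.
  rewrite -/t -{1}(scale1r t) -scalerBl -scalemxAl; congr (_ *: _).
  rewrite -rmorphM -(rmorph1 (real_complex R)) -rmorphB; congr (_%:C).
  by rewrite /k; field.
rewrite mulmxBl -addrA; congr (_ + _).
rewrite -scalemxAl -scalerN -scalerDr; congr (_ *: _).
rewrite adjmxD adjmxN (adjmxM (D^t*)) trmxCK mulmxDr mulmxN addrC; congr (_ - _).
by rewrite mulmxA.
Qed.

(** With y = w - u, the first summand of [mse] changes by 2 k Re(y^H D^H Q t) + k^2 |t|^2 |y|^2;
    factoring out k^2 |t|^2 and completing the square produces the shift [v]. The trace changes by -
    k |t|^2, and the squared norm of Q - k t t^H yields the terms in [beta] and |t|^2. *)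
Lemma mse_rank1_update (s : R) (D : 'M[C]_n) (w : 'cV[C]_n) :
  t != 0 ->
  let u := D^t* *m t in
  let v := ((1 + alpha) / enorm t ^+ 2)%:C *: (D^t* *m Q *m t) in
  let beta := (1 + alpha) * (rdot t (Q *m t) / enorm t ^+ 2) in
  mse s (G + x *m x^t*) (D + x *m w^t*) = mse s G D +
  enorm t ^+ 2 / (1 + alpha) ^+ 2 *
  (enorm (w - u + v) ^+ 2 - enorm v ^+ 2 - s * (1 + alpha)
   + 2 * s ^+ 2 * beta - s ^+ 2 * enorm t ^+ 2).
Proof.
move=> t0 u v beta.
have N0 : enorm t ^+ 2 != 0 by rewrite enorm_sqr rdot_eq0.
rewrite /mse rank1_update_mul invmx_rank1_update -/Q -/u enorm_sqrD.
have trE (A : 'M[C]_n) : complex.Re (\tr A) = rdot A 1%:M.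
  by rewrite /rdot trmx1 map_mx1 mulmx1.
rewrite !trE.
move: (w - u) => y.
rewrite !(rdotDl, rdotDr, rdotNl, rdotNr, rdotZl, rdotZr).
rewrite !(rdotC (t *m _)) !rdot_rank1 !rdot_rank1r mul1mx -enorm_sqr.
have -> : rdot (Q *m D *m y) t = rdot y (D^t* *m Q *m t).
  by rewrite rdotMl adjmxM Q_adj.
rewrite /beta (rdotC t (Q *m t)) /k.
move: (rdot y _) (rdot (Q *m t) t) (rdot Q 1%:M) (rdot Q Q) (rdot (Q *m D) _).
move: (enorm v) (enorm y) (enorm t) N0 (1 + alpha) alpha_neq.
move=> ev ey N N0 a a0 ryt qt tr qq qd; field.
by rewrite a0 andbT; apply: contra N0 => /eqP ->; rewrite expr0n.
Qed.
End rank1_update.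
End mean_square_error.

(** * The error covariance of a state *)

Section error_covariance.
Context {d : measure_display} {Om : measurableType d} {R : realType}.
Variable P : probability Om R.
Variables (Ntx Nrx Tp : nat) (sigma2 : R).
Hypothesis sigma2_gt0 : 0 < sigma2.
Variable H : Om -> 'M[R[i]]_(Ntx, Nrx).
Variable z : nat -> Om -> 'cV[R[i]]_Nrx.
Hypothesis channel_law : forall r : 'I_Nrx,
  complex_normal P 1 (fun w => col r (H w)).
Hypothesis noise_law :
  forall t : nat, (0 < t)%N -> complex_normal P sigma2 (z t).
Hypothesis channel_noise_indep :
  mutually_independent P [set o : option nat | o != Some 0%N]
    (fun o => if o is Some t then sigma_of (z t) else sigma_of H).
Variable r : 'I_Nrx.

Lemma coord_events_preimage m k (Z : Om -> 'M[R[i]]_(m, k)) ijc (B : set R) :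
  measurable B -> coord_events Z ijc (Defs.coord Z ijc @^-1` B).
Proof. by move=> mB; exists B => //; rewrite setTI. Qed.

Lemma sigma_of_preimage m k (Z : Om -> 'M[R[i]]_(m, k)) ijc (B : set R) :
  measurable B -> sigma_of Z (Defs.coord Z ijc @^-1` B).
Proof.
by move=> mB; apply: sub_sigma_algebra; exists ijc => //; exact: coord_events_preimage.
Qed.

Lemma complex_normal_coord k s (Z : Om -> 'cV[R[i]]_k) ijc :
  complex_normal P s Z -> normal_rv P (Num.sqrt (s / 2)) (Defs.coord Z ijc).
Proof. case=> mZ PZ _; split; [exact: mZ|exact: PZ]. Qed.

Lemma complex_normal_independent k s (Z : Om -> 'cV[R[i]]_k) ijc ijc' :
  complex_normal P s Z -> ijc != ijc' ->
  independent_rv P (Defs.coord Z ijc) (Defs.coord Z ijc').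
Proof.
move=> [_ _ PZ] ne A B mA mB.
by apply: (mutually_independent_pair PZ _ _ ne) => //; exact: coord_events_preimage.
Qed.

Lemma independent_rvC (X Y : Om -> R) :
  independent_rv P X Y -> independent_rv P Y X.
Proof. by move=> XY A B mA mB; rewrite setIC muleC; exact: XY. Qed.

Section fixed_times.
Variables (N : nat) (ct : 'I_N -> nat).
Hypotheses (ct_inj : injective ct) (ct_gt0 : forall l, (0 < ct l)%N).

(** The random scalars entering the estimation error at antenna [r]: its channel coefficients, and
    one noise sample per column. *)
Definition sources (j : 'I_Ntx + 'I_N) (w : Om) : R[i] :=
  match j with inl k => H w k r | inr l => z (ct l) w r 0 end.

Definition half_power (j : 'I_Ntx + 'I_N) : R :=
  match j with inl _ => 1 / 2 | inr _ => sigma2 / 2 end.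

Lemma part_channel b k :
  part b \o sources (inl k) = Defs.coord (fun w => col r (H w)) (k, 0, b).
Proof. by apply/funext => w; rewrite /= /part /Defs.coord /= mxE. Qed.

(** The law of the channel is stated for column [r], its independence from the noise for all of [H];
    each needs its own reading of a channel coordinate. *)
Lemma part_channel_full b k : part b \o sources (inl k) = Defs.coord H (k, r, b).
Proof. by []. Qed.

Lemma part_noise b l : part b \o sources (inr l) = Defs.coord (z (ct l)) (r, 0, b).
Proof. by []. Qed.

Lemma half_power_gt0 j : 0 < half_power j.
Proof. by case: j => _ /=; rewrite divr_gt0. Qed.

Lemma normal_sources j b :
  normal_rv P (Num.sqrt (half_power j)) (part b \o sources j).
Proof.
case: j => [k|l] /=.
  by rewrite part_channel; exact: complex_normal_coord.
by rewrite part_noise; apply: complex_normal_coord; exact: noise_law.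
Qed.

(** Coordinates of one Gaussian vector are independent by [complex_normal]. Channel against noise,
    and noises at different times, are covered by [channel_noise_indep]; there [ct_gt0] keeps the
    times inside the independent family and [ct_inj] separates the columns. *)
Lemma independent_sources j b k c : (j, b) != (k, c) ->
  independent_rv P (part b \o sources j) (part c \o sources k).
Proof.
have ind o o' (X Y : set Om) :=
  @mutually_independent_pair _ _ _ P _ _ _ o o' X Y channel_noise_indep.
have some0 l : Some (ct l) != Some 0%N.
  by rewrite (inj_eq Some_inj) -lt0n.
have HZ k' b' l' c' : independent_rv P (part b' \o sources (inl k'))
    (part c' \o sources (inr l')).
  move=> A B mA mB; apply: (ind None (Some (ct l'))) => //=.
  - by rewrite part_channel_full; exact: sigma_of_preimage.
  - by rewrite part_noise; exact: sigma_of_preimage.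
case: j k => [k|l] [k'|l'] ne.
- rewrite !part_channel; apply: complex_normal_independent (channel_law r) _.
  by apply: contra ne => /eqP [-> ->].
- exact: HZ.
- exact/independent_rvC/HZ.
- have [ll|ll] := eqVneq l l'.
    rewrite -ll !part_noise; apply: complex_normal_independent (noise_law (ct_gt0 l)) _.
    by apply: contra ne => /eqP [->]; rewrite ll.
  move=> A B mA mB; apply: (ind (Some (ct l)) (Some (ct l'))) => //=.
  - by rewrite (inj_eq Some_inj) (inj_eq ct_inj).
  - by rewrite part_noise; exact: sigma_of_preimage.
  - by rewrite part_noise; exact: sigma_of_preimage.
Qed.

Lemma expectation_sqmod_sources (a : 'I_Ntx -> R[i]) (c : 'I_N -> R[i]) :
  ('E_P[fun w => sqmod (\sum_k a k * H w k r +
                        \sum_l c l * (z (ct l) w r 0)^*%C)%R] =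
   ((\sum_k sqmod (a k)) + sigma2 * (\sum_l sqmod (c l)))%R%:E)%E.
Proof.
pose ac (j : 'I_Ntx + 'I_N) := match j with inl k => a k | inr l => c l end.
pose cj (j : 'I_Ntx + 'I_N) := if j is inr _ then true else false.
have := @expectation_sqmod_linear _ _ _ P _ sources cj half_power ac.
under [X in ('E_P[X])%E]eq_fun do rewrite big_sumType /=.
move=> ->.
- congr EFin; rewrite big_sumType /= mulrDr !mulr_sumr; congr (_ + _);
    by apply: eq_bigr => j _; field.
- move=> j b; apply: (normal_rv_Lfun2 _ (normal_sources j b)).
  by rewrite sqrtr_gt0 half_power_gt0.
- move=> j b k c'; have sp j' : 0 < Num.sqrt (half_power j').
    by rewrite sqrtr_gt0 half_power_gt0.
  have [[<- <-]|ne] := eqVneq.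
    rewrite (normal_rv_second_moment (sp j) (normal_sources j b)).
    by rewrite sqr_sqrtr ?ltW ?half_power_gt0.
  exact: expectation_normal_rvM (sp j) (sp k) (normal_sources j b)
    (normal_sources k c') (independent_sources ne).
Qed.
End fixed_times.

Lemma Re_mul_adjmx n (f : 'cV[R[i]]_n) i :
  complex.Re ((f *m f^t*) i i) = sqmod (f i 0).
Proof.
rewrite mxE big_ord1 !mxE /sqmod; case: (f i 0) => a b.
by rewrite /Num.conj /=; ring.
Qed.

(** The error is B h plus E applied to the conjugated noise, so the trace is |B|^2 + sigma2 |E|^2.
    Then B = - A D since A G = 1, and replacing Xhat Xhat^H by G - sigma2 I turns |E|^2 into Tr A -
    sigma2 |A|^2. *)
Lemma Re_tr_error_cov (S : state R Ntx) :
  injective (fun l : 'I_(ncol S) => column_time Tp S l) ->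
  (forall l : 'I_(ncol S), (0 < column_time Tp S l)%N) ->
  complex.Re (\tr (error_cov P Tp sigma2 H z r S)) =
  mse sigma2 (used S *m (used S)^t* + (sigma2%:C)%:M)
             (used S *m (used S - sent S)^t* + (sigma2%:C)%:M).
Proof.
move=> ct_inj ct_gt0.
set G := used S *m (used S)^t* + (sigma2%:C)%:M.
set A := invmx G.
pose B := A *m used S *m (sent S)^t* - 1%:M.
pose E := A *m used S.
have GU : G \in unitmx := regularized_gram_unit (used S) sigma2_gt0.
have GH : G^t* = G := regularized_gram_adj sigma2 (used S).
have AH : A^t* = A by rewrite adjmx_inv GH.
transitivity (rdot B B + sigma2 * rdot E E).
  rewrite /mxtrace raddf_sum !rdotE mulr_sumr -big_split; apply: eq_bigr => i _.
  rewrite mxE /=.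
  set X := (X in fine 'E_P[X]).
  have -> : X = fun w => sqmod (\sum_k B i k * H w k r +
      \sum_(l < ncol S) E i l * (z (column_time Tp S l) w r 0)^*%C)%R.
    apply/funext => w; rewrite /X.
    set e := channel_estimate _ _ _ _ _ _ _.
    have -> : e - col r (H w) = B *m col r (H w) + E *m
       (\row_(l < ncol S) z (column_time Tp S l) w r 0)^t*.
      rewrite /e /channel_estimate -/G -/A /received.
      by rewrite adjmxD adjmxM trmxCK mulmxDr mulmxBl mul1mx mulmxA addrAC.
    rewrite Re_mul_adjmx; congr sqmod; rewrite !mxE; congr (_ + _).
      by apply: eq_bigr => k _; congr (_ * _); rewrite mxE.
    by apply: eq_bigr => l _; rewrite !mxE.
  rewrite (expectation_sqmod_sources ct_inj ct_gt0) /=.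
  by rewrite /sqmod; congr (_ + _ * _); apply: eq_bigr => j _; rewrite !expr2.
rewrite /mse -/A; congr (_ + _ * _).
  have -> : B = - (A *m (used S *m (used S - sent S)^t* + (sigma2%:C)%:M)).
    have -> : used S *m (used S - sent S)^t* + (sigma2%:C)%:M =
        G - used S *m (sent S)^t*.
      by rewrite adjmxD adjmxN mulmxDr mulmxN addrAC.
    by rewrite mulmxBr mulVmx// opprB mulmxA.
  by rewrite rdotNl rdotNr opprK.
have -> : complex.Re (\tr A) = rdot A 1%:M.
  by rewrite /rdot trmx1 map_mx1 mulmx1.
rewrite /E rdotMr -mulmxA.
have -> : used S *m (used S)^t* = G - (sigma2%:C)%:M by rewrite addrK.
rewrite mulmxBr mulVmx// mul_mx_scalar rdotDr rdotNr rdotZr.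
by congr (_ - _).
Qed.

End error_covariance.

(** * Virtual states *)

Section state_times.
Variables (R : realType) (Ntx Tp : nat).
Implicit Types S : state R Ntx.

(* Ensures that the columns of S are received at distinct positive times, so
   that their noises are independent. *)
Definition well_timed S :=
  ncol S = (Tp + #|` times S|)%N /\ forall t, t \in times S -> (Tp < t)%N.

Lemma well_timed_column_time_inj S : well_timed S ->
  injective (fun l : 'I_(ncol S) => column_time Tp S l).
Proof.
move=> [nS tS] l l' /=; rewrite /column_time /nth_time.
have inM (i : 'I_(ncol S)) : (i < Tp)%N = false ->
    (i - Tp < size (sort leq (times S)))%N.
  move=> iT; rewrite size_sort.
  have : (i < Tp + #|` times S|)%N by rewrite -nS ltn_ord.
  by have := leqNgt Tp i; rewrite iT /= => Ti; rewrite ltn_subLR.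
have memM (i : 'I_(ncol S)) : (i < Tp)%N = false ->
    (Tp < nth 0%N (sort leq (times S)) (i - Tp))%N.
  by move=> iT; apply: tS; rewrite -(mem_sort leq) mem_nth// inM.
case: ifP => lT; case: ifP => l'T.
- by move=> [] /ord_inj.
- move=> e; have := memM _ l'T; rewrite -e ltnS => h.
  by move: (leq_trans lT h); rewrite ltnn.
- move=> e; have := memM _ lT; rewrite e ltnS => h.
  by move: (leq_trans l'T h); rewrite ltnn.
- move=> /eqP; rewrite nth_uniq ?inM// ?sort_uniq ?fset_uniq// => /eqP e.
  apply/ord_inj; move: lT l'T => /negbT; rewrite -leqNgt => lT /negbT.
  by rewrite -leqNgt => l'T; rewrite -(subnK lT) e subnK.
Qed.

Lemma well_timed_column_time_gt0 S (l : 'I_(ncol S)) : well_timed S ->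
  (0 < column_time Tp S l)%N.
Proof.
move=> [nS tS]; rewrite /column_time; case: ifP => // /negbT; rewrite -leqNgt => Tl.
apply: leq_ltn_trans (leq0n Tp) _; apply: tS; rewrite /nth_time.
rewrite -(mem_sort leq) mem_nth// size_sort ltn_subLR//.
by rewrite -nS ltn_ord.
Qed.

Variables (K n : nat) (xs : 'I_K -> 'cV[R[i]]_Ntx).
Variables (xhat xtilde : nat -> 'cV[R[i]]_Ntx).

Lemma is_state_well_timed (Xp : 'M[R[i]]_(Ntx, Tp)) S :
  is_state Xp xs xhat n S ->
  well_timed S /\ forall t, t \in times S -> (t < n)%N.
Proof.
move=> [M [k [tM ->]]]; split; first by split=> //= t /tM /andP[].
by move=> t /tM /andP[].
Qed.

Hypothesis Tp_lt_n : (Tp < n)%N.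

Lemma well_timed_next_state S a (j : 'I_(outcomes K a)) :
  well_timed S -> (forall t, t \in times S -> (t < n)%N) ->
  well_timed (next_state xs xhat n S j) /\
  forall t, t \in times (next_state xs xhat n S j) -> (t < n.+1)%N.
Proof.
move=> wS Sn; case: a j => j; last by split=> // t /Sn /ltnW.
have nS : n \notin times S by apply/negP => /Sn; rewrite ltnn.
have [cS tS] := wS; split; last first.
  by move=> t; rewrite /= !inE => /orP[/Sn /ltnW|/eqP ->].
split=> /=.
  by rewrite fsetUC cardfsU1 nS cS (addnC 1%N) addnA.
by move=> t; rewrite !inE => /orP[/tS|/eqP ->].
Qed.

(** The appended times start at n + 1, beyond all times of the next state, so the union is disjoint
    and its size matches the column count. *)
Lemma well_timed_virtual_state S m a (j : 'I_(outcomes K a)) :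
  well_timed S -> (forall t, t \in times S -> (t < n)%N) ->
  well_timed (virtual_state xs xhat xtilde n S m j).
Proof.
move=> wS Sn; have [[cU tU] Un] := well_timed_next_state j wS Sn.
rewrite /virtual_state; case: ifP => // _; split => /=.
  rewrite cU -addnA; congr (_ + _)%N.
  rewrite cardfsU (_ : (_ `&` _)%fset = fset0).
    by rewrite cardfs0 subn0 card_fseq undup_id ?iota_uniq// size_iota.
  apply/fsetP => t; rewrite !inE mem_iota; apply/negbTE/negP.
  by move=> /andP[/Un tn /andP[nt _]]; rewrite ltnNge nt in tn.
move=> t; rewrite !inE mem_iota => /orP[/tU//|/andP[nt _]].
exact: ltn_trans Tp_lt_n nt.
Qed.

Lemma columns_mul_adjmx (x y : nat -> 'cV[R[i]]_Ntx) t1 t2 :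
  columns x t1 t2 *m (columns y t1 t2)^t* =
  \sum_(t1 <= m < t2) x m *m (y m)^t*.
Proof.
apply/matrixP => i j; rewrite summxE mxE.
rewrite -[t1 in RHS]add0n big_addn big_mkord; apply: eq_bigr => l _.
by rewrite !mxE big_ord1 !mxE addnC.
Qed.

Lemma row_mx_mul_adjmx m p q (A B : 'M[R[i]]_(m, p)) (E F : 'M[R[i]]_(m, q)) :
  row_mx A E *m (row_mx B F)^t* = A *m B^t* + E *m F^t*.
Proof. by rewrite tr_row_mx map_col_mx mul_row_col. Qed.

Lemma next_state_gram S (j : 'I_K) :
  let U := next_state xs xhat n S (a := true) j in
  used U *m (used U)^t* = used S *m (used S)^t* + xhat n *m (xhat n)^t*.
Proof. exact: row_mx_mul_adjmx. Qed.

Lemma next_state_mismatch S (j : 'I_K) :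
  let U := next_state xs xhat n S (a := true) j in
  used U *m (used U - sent U)^t* =
  used S *m (used S - sent S)^t* + xhat n *m (xhat n - xs j)^t*.
Proof. by move=> U; rewrite /U /= opp_row_mx add_row_mx row_mx_mul_adjmx. Qed.

Lemma virtual_state_gram S m a (j : 'I_(outcomes K a)) : (n < m)%N ->
  let U := next_state xs xhat n S j in
  let W := virtual_state xs xhat xtilde n S m j in
  used W *m (used W)^t* =
  used U *m (used U)^t* + \sum_(n.+1 <= l < m) xtilde l *m (xtilde l)^t*.
Proof.
move=> nm U W; rewrite /W /virtual_state; case: ifP => mn /=.
  by rewrite big_geq// addr0.
by rewrite row_mx_mul_adjmx columns_mul_adjmx.
Qed.

(** The soft-decision columns of [used] and [sent] coincide, so their difference is zero. *)
Lemma virtual_state_mismatch S m a (j : 'I_(outcomes K a)) : (n < m)%N ->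
  let U := next_state xs xhat n S j in
  let W := virtual_state xs xhat xtilde n S m j in
  used W *m (used W - sent W)^t* = used U *m (used U - sent U)^t*.
Proof.
move=> nm U W; rewrite /W /virtual_state; case: ifP => mn //=.
by rewrite opp_row_mx add_row_mx subrr row_mx_mul_adjmx trmx0 map_mx0 mulmx0 addr0.
Qed.
End state_times.

(** * A-posteriori probabilities *)

Section detection.
Variables (R : realType) (Ntx Nrx K : nat) (sigma2 : R).
Variables (xs : 'I_K -> 'cV[R[i]]_Ntx) (Hdet : nat -> 'M[R[i]]_(Ntx, Nrx)).
Variable y : nat -> 'cV[R[i]]_Nrx.

Lemma likelihood_sum_gt0 t : (0 < K)%N ->
  0 < \sum_(j < K) likelihood sigma2 xs Hdet y j t.
Proof.
case: K xs => // K' xs' _; rewrite big_ord_recl ltr_wpDr ?expR_gt0//.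
by apply: sumr_ge0 => i _; exact: expR_ge0.
Qed.

Lemma app_ge0 k t : 0 <= app sigma2 xs Hdet y k t.
Proof.
rewrite divr_ge0 ?expR_ge0//; apply: sumr_ge0 => i _; exact: expR_ge0.
Qed.

Lemma app_sum1 t : (0 < K)%N -> \sum_k app sigma2 xs Hdet y k t = 1.
Proof.
by move=> K0; rewrite -mulr_suml divff// gt_eqF// likelihood_sum_gt0.
Qed.
End detection.

(** * Comparison of the two actions *)

Theorem theorem1 (R : realType) (d : measure_display) (Om : measurableType d)
  (P : probability Om R)
  (Ntx Nrx Tp Td NB : nat) (sigma2 : R)
  (Ntx_gt0 : (0 < Ntx)%N) (Nrx_gt0 : (0 < Nrx)%N) (Tp_gt0 : (0 < Tp)%N)
  (Td_gt0 : (0 < Td)%N) (NB_gt0 : (0 < NB)%N) (sigma2_gt0 : 0 < sigma2)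
  (* channel and noise *)
  (H : Om -> 'M[R[i]]_(Ntx, Nrx)) (z : nat -> Om -> 'cV[R[i]]_Nrx)
  (channel_law : forall r : 'I_Nrx,
    complex_normal P 1 (fun w => col r (H w)))
  (noise_law : forall t : nat, (0 < t)%N -> complex_normal P sigma2 (z t))
  (* None stands for the channel, Some t for the noise at time t *)
  (channel_noise_indep :
    mutually_independent P [set o : option nat | o != Some 0%N]
      (fun o => if o is Some t then sigma_of (z t) else sigma_of H))
  (Xp : 'M[R[i]]_(Ntx, Tp))
  (* constellation and data symbol vectors *)
  (constel : {fset R[i]})
  (K : nat) (K_def : K = (#|` constel| ^ Ntx)%N)
  (xs : 'I_K -> 'cV[R[i]]_Ntx)
  (xs_inj : injective xs)
  (xs_enum : forall v : 'cV[R[i]]_Ntx,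
    (exists k, xs k = v) <-> (forall i, v i 0 \in constel))
  (* fixed outputs of the data detector *)
  (Hdet : nat -> 'M[R[i]]_(Ntx, Nrx)) (y : nat -> 'cV[R[i]]_Nrx)
  (xhat : nat -> 'cV[R[i]]_Ntx)
  (xhat_argmax : forall t : nat, (Tp < t <= Tp + NB * Td)%N ->
    exists2 k, xhat t = xs k &
      forall j, app sigma2 xs Hdet y j t <= app sigma2 xs Hdet y k t)
  (r : 'I_Nrx) (b n : nat)
  (b_range : (1 <= b <= NB)%N)
  (n_range : (Tp + b.-1 * Td < n <= Tp + b * Td)%N)
  (S : state R Ntx) (S_state : is_state Xp xs xhat n S)
  (xhat_neq0 : xhat n != 0)
  (trans : state R Ntx -> forall a : bool, 'I_(outcomes K a) -> R)
  (V : state R Ntx -> R) :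
  let theta := app sigma2 xs Hdet y in
  let xtilde := soft_decision sigma2 xs Hdet y in
  let L := (Tp + b * Td)%N in
  let rew := reward P Tp sigma2 H z r in
  (* (A1) *)
  (forall j : 'I_(outcomes K true), trans S true j = theta j n) ->
  (forall j : 'I_(outcomes K false), trans S false j = 1) ->
  (* (A2) *)
  (forall (a : bool) (j : 'I_(outcomes K a)),
    V (next_state xs xhat n S j) =
    \sum_(n.+1 <= m < L.+1)
      rew (virtual_state xs xhat xtilde n S m j)
          (virtual_state xs xhat xtilde n S m.+1 j)) ->
  let X := sent S in
  let Xhat := used S in
  let Q := invmx (Xhat *m Xhat^t*
                  + \sum_(n.+1 <= m < L.+1) xtilde m *m (xtilde m)^t*
                  + (sigma2%:C)%:M) in
  let D := Xhat *m (Xhat - X)^t* + (sigma2%:C)%:M in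
  let t := Q *m xhat n in
  let u := D^t* *m t in
  let e := xhat n - xtilde n in
  let alpha := complex.Re (((xhat n)^t* *m Q *m xhat n) 0 0) in
  let beta :=
    (1 + alpha) * (complex.Re ((t^t* *m Q *m t) 0 0) / enorm t ^+ 2) in
  let v := ((1 + alpha) / enorm t ^+ 2)%:C *: (D^t* *m Q *m t) in
  let delta := \sum_j theta j n * enorm (xhat n - xs j) ^+ 2
               - enorm (xhat n - xtilde n) ^+ 2 in
  optimal_policy trans rew V (@next_state R Ntx K xs xhat n) S =
  (1 <= (sigma2 * (1 + alpha) + sigma2 ^+ 2 * enorm t ^+ 2 + enorm v ^+ 2)
        / (2 * sigma2 ^+ 2 * beta + delta + enorm (e - u + v) ^+ 2)).
Proof.
move=> theta xtilde L rew trans1 trans0 V_sum X Xhat Q D t u e alpha beta v delta.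
have /andP[b_gt0 b_le] := b_range; have /andP[n_gt n_le] := n_range.
have Tp_lt_n : (Tp < n)%N by rewrite (leq_ltn_trans _ n_gt)// leq_addr.
have n_le_L : (n < L.+1)%N by [].
(* A detected vector exists at time n, so there is at least one symbol vector; hence the theta sum
   to 1. *)
have K_gt0 : (0 < K)%N.
  have [|k _ _] := xhat_argmax n; last exact: leq_ltn_trans (leq0n _) (ltn_ord k).
  by rewrite Tp_lt_n (leq_trans n_le)// leq_add2l leq_mul2r b_le orbT.
have [S_timed S_lt_n] := is_state_well_timed S_state.
(* [phi] is a potential: each reward is a difference of its values, so the sum in (A2) telescopes to
   the last virtual state. *)
pose phi S' := complex.Re (\tr (error_cov P Tp sigma2 H z r S')).
pose final a j := virtual_state xs xhat xtilde n S L.+1 (a := a) j.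
have QE a : Qvalue trans rew V (@next_state R Ntx K xs xhat n) S a =
    \sum_j trans S a j * (phi S - phi (final a j)).
  have rewE S1 S2 : rew S1 S2 = phi S1 - phi S2 by rewrite /rew /reward !raddfB.
  apply: eq_bigr => j _; congr (_ * _); rewrite V_sum rewE.
  have -> : \sum_(n.+1 <= m < L.+1) rew (virtual_state xs xhat xtilde n S m j)
        (virtual_state xs xhat xtilde n S m.+1 j) =
      phi (next_state xs xhat n S j) - phi (final a j).
    have -> : next_state xs xhat n S j = virtual_state xs xhat xtilde n S n.+1 j.
      by rewrite /virtual_state leqnn.
    under eq_bigr do rewrite rewE -opprB.
    by rewrite sumrN telescope_sumr// opprB.
  by rewrite addrA subrK.
(* Appending the soft decisions to Xhat exhibits the inverse of [Q] as a regularized Gram matrix. *)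
pose Y := row_mx Xhat (columns xtilde n.+1 L.+1).
pose G := Y *m Y^t* + (sigma2%:C)%:M.
have GE : Xhat *m Xhat^t* + \sum_(n.+1 <= m < L.+1) xtilde m *m (xtilde m)^t* +
    (sigma2%:C)%:M = G.
  by rewrite /G row_mx_mul_adjmx columns_mul_adjmx.
have G_unit : G \in unitmx := regularized_gram_unit Y sigma2_gt0.
have G_adj : G^t* = G := regularized_gram_adj sigma2 Y.
have QG : Q = invmx G by rewrite /Q GE.
have phiE a j : phi (final a j) =
    mse sigma2 (used (final a j) *m (used (final a j))^t* + (sigma2%:C)%:M)
      (used (final a j) *m (used (final a j) - sent (final a j))^t* +
       (sigma2%:C)%:M).
  have W : well_timed Tp (final a j) by exact: well_timed_virtual_state.
  apply: Re_tr_error_cov => //.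
  - exact: well_timed_column_time_inj.
  - by move=> l; exact: well_timed_column_time_gt0.
have phi0 j : phi (final false j) = mse sigma2 G D.
  rewrite phiE (virtual_state_gram _ _ _ S j n_le_L).
  by rewrite (virtual_state_mismatch _ _ _ S j n_le_L) GE.
have phi1 (j : 'I_K) : phi (final true j) =
    mse sigma2 (G + xhat n *m (xhat n)^t*) (D + xhat n *m (xhat n - xs j)^t*).
  have -> : G + xhat n *m (xhat n)^t* = Xhat *m Xhat^t* + xhat n *m (xhat n)^t* +
      \sum_(n.+1 <= m < L.+1) xtilde m *m (xtilde m)^t* + (sigma2%:C)%:M.
    by rewrite -GE addrAC; congr (_ + _); rewrite addrAC.
  have -> : D + xhat n *m (xhat n - xs j)^t* = Xhat *m (Xhat - X)^t* +
      xhat n *m (xhat n - xs j)^t* + (sigma2%:C)%:M by rewrite /D addrAC.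
  rewrite phiE (virtual_state_gram _ _ _ S (a := true) j n_le_L).
  rewrite (virtual_state_mismatch _ _ _ S (a := true) j n_le_L).
  by rewrite (next_state_gram n xs xhat S j) (next_state_mismatch n xs xhat S j).
have Q_pos (w : 'cV[R[i]]_Ntx) : w != 0 -> 0 < rdot w (Q *m w).
  by rewrite QG; exact: (rdot_invmx_regularized_gram_gt0 Y sigma2_gt0).
(* Keeps unification from unfolding these terms. *)
clearbody G D phi Q.
have t_neq0 : t != 0.
  apply: contra xhat_neq0 => /eqP t0.
  by rewrite -[xhat n](mulKVmx G_unit) -QG -/t t0 mulmx0.
have alphaE : rdot (xhat n) t = alpha by rewrite /alpha -mulmxA rdot_col rdotC.
have alpha_gt0 : 0 < alpha by rewrite -alphaE; exact: Q_pos.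
have betaE : (1 + alpha) * (rdot t (Q *m t) / enorm t ^+ 2) = beta.
  by rewrite /beta -mulmxA rdot_col rdotC.
have N_gt0 : 0 < enorm t ^+ 2.
  by rewrite enorm_sqr lt_neqAle rdot_ge0 andbT eq_sym rdot_eq0.
have beta_gt0 : 0 < beta.
  by rewrite -betaE mulr_gt0 ?divr_gt0 ?Q_pos// ltr_wpDl.
have theta1 : \sum_j theta j n = 1 by exact: app_sum1.
have eE : e = \sum_j (theta j n)%:C *: (xhat n - xs j).
  under eq_bigr do rewrite scalerBr.
  by rewrite big_split /= sumrN -scaler_suml -rmorph_sum theta1 scale1r.
have meanE c : \sum_j theta j n * enorm (xhat n - xs j + c) ^+ 2 =
    delta + enorm (e + c) ^+ 2.
  by rewrite (enorm_sqr_mean (fun j => xhat n - xs j) c theta1) -eE.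
(* The shift c = - e exhibits delta as a variance. *)
have delta_ge0 : 0 <= delta.
  have := meanE (- e); rewrite subrr [X in _ + X]enorm_sqr rdot0l addr0 => <-.
  by apply: sumr_ge0 => j _; rewrite mulr_ge0 ?sqr_ge0// app_ge0.
set num := _ + enorm v ^+ 2; set den := _ + enorm (e - u + v) ^+ 2.
(* Strict because beta > 0; the condition on the ratio thus becomes den <= num. *)
have den_gt0 : 0 < den.
  rewrite /den ltr_pwDl ?sqr_ge0// ltr_pwDl// mulr_gt0// mulr_gt0//.
  by rewrite exprn_gt0.
have diffE : \sum_j theta j n * (phi (final true j) - mse sigma2 G D) =
    enorm t ^+ 2 / (1 + alpha) ^+ 2 * (den - num).
  have a_neq0 : 1 + alpha != 0 by rewrite gt_eqF// ltr_wpDl.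
  have addE (w : 'cV[R[i]]_Ntx) : w - u + v = w + (v - u).
    by rewrite -addrA (addrC v).
  (* [c] collects the terms that do not depend on the outcome j; only the squared norm is averaged
     over theta. *)
  pose c := 2 * sigma2 ^+ 2 * beta - enorm v ^+ 2 - sigma2 * (1 + alpha)
    - sigma2 ^+ 2 * enorm t ^+ 2.
  have phi_diff (j : 'I_K) : phi (final true j) - mse sigma2 G D =
      enorm t ^+ 2 / (1 + alpha) ^+ 2 *
      (enorm (xhat n - xs j + (v - u)) ^+ 2 + c).
    have := @mse_rank1_update _ _ G (xhat n) G_unit G_adj.
    rewrite -QG -/t alphaE => /(_ a_neq0 sigma2 D (xhat n - xs j) t_neq0) /=.
    rewrite -/u -/v betaE phi1 => ->.
    by rewrite addrC addKr addE /c; congr (_ * _); ring.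
  under eq_bigr do rewrite phi_diff mulrCA mulrDr.
  rewrite -mulr_sumr big_split /= meanE -mulr_suml theta1 mul1r.
  by congr (_ * _); rewrite /den /num /c addE; ring.
rewrite ler_pdivlMr// mul1r /optimal_policy.
have -> : (true \in maximizers (Qvalue trans rew V (@next_state R Ntx K xs xhat n) S)) =
   (Qvalue trans rew V (@next_state R Ntx K xs xhat n) S false <=
    Qvalue trans rew V (@next_state R Ntx K xs xhat n) S true).
  apply/forallP/idP => [/(_ false)//|h [] //].
rewrite !QE.
have -> : \sum_j trans S false j * (phi S - phi (final false j)) =
    phi S - mse sigma2 G D.
  by rewrite big_ord1 trans0 mul1r phi0.
have -> : \sum_j trans S true j * (phi S - phi (final true j)) =
    phi S - mse sigma2 G D -
    \sum_j theta j n * (phi (final true j) - mse sigma2 G D).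
  rewrite -[phi S - mse sigma2 G D in RHS]mul1r -theta1 mulr_suml -sumrB.
  by apply: eq_bigr => j _; rewrite trans1; ring.
(* Action 1 is optimal iff the averaged change of Tr C_e is at most 0; its prefactor |t|^2 / (1 +
   alpha)^2 is positive, which leaves den <= num. *)
rewrite diffE lerBrDl gerDr pmulr_rle0 ?subr_le0 ?divr_gt0//.
  by case: ifP.
by rewrite exprn_gt0// ltr_wpDl.
Qed.
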